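(* Let $K$ be a field of characteristic zero, $S=K[x_1,x_2,x_3]$, and let $d_1,d_2,d_3$ be positive integers. Then for a generic sequence $f_1,f_2,f_3$ of homogeneous polynomials of degrees $d_1,d_2,d_3$, the initial ideal $\operatorname{in}(I)$ of $I=(f_1,f_2,f_3)$ with respect to the reverse lexicographic order is an almost reverse lexicographic ideal. (That is, Moreno's conjecture holds for $n=3$.)
   Context: The reverse lexicographic order on $S$ is taken with $x_1>x_2>x_3$: for monomials of the same degree, $x^a>x^b$ iff the last nonzero entry of $a-b$ is negative. A property holds for a generic sequence of homogeneous polynomials of degrees $d_1,d_2,d_3$ if there is a nonempty Zariski open subset $U\subseteq S_{d_1}\times S_{d_2}\times S_{d_3}$ such that the property holds for every $(f_1,f_2,f_3)\in U$. A monomial ideal $J$ is almost reverse lexicographic if whenever $u$ is a minimal monomial generator of $J$ and $v$ is a monomial with $\deg v=\deg u$ and $v>u$ in the reverse lexicographic order, then $v\in J$. *)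

(* Defs.v *)
From HB Require Import structures.
From mathcomp Require Import all_boot all_order all_algebra.
From mathcomp Require Import mpoly.

Set Implicit Arguments.
Unset Strict Implicit.
Unset Printing Implicit Defensive.

Import Order.TTheory GRing.Theory.
Local Open Scope ring_scope.

Section Defs.
Variable K : fieldType.

(* S = K[x_1,x_2,x_3]; variable x_(i+1) is 'X_i, i : 'I_3. *)
Notation S := {mpoly K[3]}.

Definition ideal_gen {n : nat} (G : {mpoly K[n]} -> Prop) : {mpoly K[n]} -> Prop :=
  fun p => exists (k : nat) (h g : 'I_k -> {mpoly K[n]}),
    (forall i, G (g i)) /\ p = \sum_(i < k) h i * g i.

Definition revlex_gt (a b : 'X_{1..3}) : bool :=
  (mdeg b < mdeg a)%N ||
  ((mdeg a == mdeg b) &&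
   [exists j : 'I_3, (a j < b j)%N &&
                     [forall k : 'I_3, (j < k)%N ==> (a k == b k)]]).

Definition is_lead_mon (g : S) (m : 'X_{1..3}) : Prop :=
  m \in msupp g /\ forall m', m' \in msupp g -> m' != m -> revlex_gt m m'.

Definition initial_ideal (I : S -> Prop) : S -> Prop :=
  ideal_gen (fun q => exists (g : S) (m : 'X_{1..3}), I g /\ is_lead_mon g m /\ q = 'X_[m]).

Definition min_mon_gen (J : S -> Prop) (u : 'X_{1..3}) : Prop :=
  J 'X_[u] /\ forall w : 'X_{1..3}, (w <= u)%MM -> w != u -> ~ J 'X_[w].

Definition almost_revlex (J : S -> Prop) : Prop :=
  forall u : 'X_{1..3}, min_mon_gen J u ->
  forall v : 'X_{1..3}, mdeg v = mdeg u -> revlex_gt v u -> J 'X_[v].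

(* Coordinates on S_d: coefficients at the monomials of degree <= d
   (those of degree < d are identically 0 on S_d). *)
Definition nmon (d : nat) : nat := #|{: 'X_{1..3 < d.+1}}|.

Definition coord_blk (d : nat) (f : S) (j : 'I_(nmon d)) : K :=
  f@_(val (@enum_val _ (pred_of_simpl predT) j)).

Definition coords (d1 d2 d3 : nat) (f1 f2 f3 : S)
  : 'I_(nmon d1 + nmon d2 + nmon d3) -> K :=
  fun j => match split j with
           | inl j12 => match split j12 with
                        | inl a => coord_blk f1 a
                        | inr b => coord_blk f2 b
                        end
           | inr c => coord_blk f3 c
           end.

Definition in_space (d1 d2 d3 : nat) (f1 f2 f3 : S) : Prop :=
  f1 \is d1.-homog /\ f2 \is d2.-homog /\ f3 \is d3.-homog.

Definition zariski_open (d1 d2 d3 : nat) (U : S -> S -> S -> Prop) : Prop :=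
  exists F : {mpoly K[nmon d1 + nmon d2 + nmon d3]} -> Prop,
    forall f1 f2 f3, in_space d1 d2 d3 f1 f2 f3 ->
      (U f1 f2 f3 <-> exists P, F P /\ P.@[@coords d1 d2 d3 f1 f2 f3] != 0).

Definition generic (d1 d2 d3 : nat) (Pr : S -> S -> S -> Prop) : Prop :=
  exists U : S -> S -> S -> Prop,
    zariski_open d1 d2 d3 U /\
    (exists f1 f2 f3, in_space d1 d2 d3 f1 f2 f3 /\ U f1 f2 f3) /\
    (forall f1 f2 f3, in_space d1 d2 d3 f1 f2 f3 -> U f1 f2 f3 -> Pr f1 f2 f3).

End Defs.

(* Main.v *)
(** Order the monomials of degree d by revlex and let rho(f, d, N) be the number
    of leading monomials of the degree-d part of I = (f_1, f_2, f_3) among the N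
    first positions.  It is the rank of a projection of I_d, hence maximal on a
    nonempty open set.  For f in that set:

    - comparison with f* = (x_1^d_1, x_2^d_2, (x_3 - x_1 - x_2)^d_3), for which
      x_3 is a strong Lefschetz element (an sl_2 argument), shows that x_3^k has
      maximal rank on S/I; the Hilbert functions agree because for generic f the
      products X^(w - d_i e_i) f_i, with w in (x_1^d_1, x_2^d_2, x_3^d_3) and
      i the first index with x_i^d_i | w, already span I_d;
    - comparison with the image of f under x_2 -> x_2 + c x_1, for c generic,
      shows that among the monomials with a fixed power of x_3 the leading ones
      are as large as the rank allows (a Wronskian argument).

    Let u be a minimal generator of in(I) and v > u of the same degree with v
    outside in(I).  If the exponent l of x_3 in v is smaller than in u, the
    maximal rank of x_3^(l+1) forces u / x_3^(l+1) to lie in in(I); otherwise v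
    and u have the same x_3-exponent, and the second point is contradicted. *)
Require Import Defs.
From HB Require Import structures.
From mathcomp Require Import all_boot all_order all_algebra.
From mathcomp Require Import perm mpoly.
From Stdlib Require Import Classical ClassicalEpsilon.
From mathcomp Require Import ring zify.

Set Implicit Arguments.
Unset Strict Implicit.
Unset Printing Implicit Defensive.

Import Order.TTheory GRing.Theory.
Local Open Scope ring_scope.

Local Notation i0 := (0 : 'I_3).
Local Notation i1 := (1 : 'I_3).
Local Notation i2 := (2%:R : 'I_3).

(** * Univariate polynomials over a field of characteristic zero *)

Lemma infinite_nonroot (K : fieldType) (charK : [pchar K] =i pred0)
  (p : {poly K}) : p != 0 -> exists t, p.[t] != 0.
Proof.
move=> p0; apply: NNPP => nex.
(* In characteristic zero the images of 0, ..., [size p] - 1 are distinct, one more than the number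
   of roots [p] can have. *)
have := max_poly_roots (rs := [seq i%:R | i <- iota 0 (size p)]) p0.
rewrite size_map size_iota ltnn => H.
suff: false by []; apply: H.
  apply/allP => t _; apply/rootP/eqP; apply: contraT => pt.
  by case: nex; exists t.
rewrite map_inj_uniq ?iota_uniq // => i j /eqP.
wlog le_ij : i j / (i <= j)%N => [W e|].
  by case: (leqP i j) => [/W|/ltnW /W H]; [apply|apply/esym/H; rewrite eq_sym].
rewrite eq_sym -subr_eq0 -natrB // (proj1 (pcharf0P K) charK) subn_eq0 => le_ji.
by apply/eqP; rewrite eqn_leq le_ij.
Qed.

Lemma horner_mmap (K : fieldType) n (h : 'I_n -> {poly K}) (Q : {mpoly K[n]}) t :
  (mmap polyC h Q).[t] = Q.@[fun i => (h i).[t]].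
Proof.
rewrite /meval /mmap horner_sum; apply: eq_bigr => m _.
rewrite hornerM hornerC /mmap1 horner_prod; congr (_ * _).
by apply: eq_bigr => i _; rewrite horner_exp.
Qed.

(** * Generic families of forms *)

Section Generic.
Variables (K : fieldType) (ds : 'I_3 -> nat).
Notation S := {mpoly K[3]}.

Definition homs (F : 'I_3 -> S) : Prop := forall i, F i \is (ds i).-homog.

Definition family_coords (F : 'I_3 -> S) := @coords K (ds i0) (ds i1) (ds i2) (F i0) (F i1) (F i2).

Definition polyfun (phi : ('I_3 -> S) -> K) : Prop :=
  exists Q : {mpoly K[nmon (ds i0) + nmon (ds i1) + nmon (ds i2)]},
    forall F, homs F -> phi F = Q.@[family_coords F].

(* [Pr] holds on a nonempty principal open subset of the space of families
   of forms of degrees [ds]. *)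
Definition generically (Pr : ('I_3 -> S) -> Prop) : Prop :=
  exists2 phi, polyfun phi &
    (exists2 F, homs F & phi F != 0) /\ (forall F, homs F -> phi F != 0 -> Pr F).

Lemma ord3P (P : 'I_3 -> Prop) : P i0 -> P i1 -> P i2 -> forall i, P i.
Proof.
move=> H0 H1 H2 [[|[|[|//]]] lt_i].
- by rewrite (_ : Ordinal _ = i0) //; apply/val_inj.
- by rewrite (_ : Ordinal _ = i1) //; apply/val_inj.
- by rewrite (_ : Ordinal _ = i2) //; apply/val_inj.
Qed.

Lemma family_coords_line F G t : family_coords (fun i => F i + t *: (G i - F i)) =1
  fun j => family_coords F j + t * (family_coords G j - family_coords F j).
Proof.
move=> j; rewrite /family_coords /coords /coord_blk.
by case: split => [j'|j']; first case: split => [j''|j''];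
   rewrite mcoeffD mcoeffZ mcoeffB.
Qed.

Lemma hom_line F G t : homs F -> homs G -> homs (fun i => F i + t *: (G i - F i)).
Proof. by move=> hF hG i; rewrite rpredD // rpredZ // rpredB. Qed.

(** Both polynomials are restricted to the line joining a witness of one to a witness of the other.
    Neither restriction is identically zero, so some point of the line avoids the zeros of both. *)
Lemma generically_and (charK : [pchar K] =i pred0) Pr1 Pr2 :
  generically Pr1 -> generically Pr2 -> generically (fun F => Pr1 F /\ Pr2 F).
Proof.
move=> [phi [Q HQ] [[F hF F0] HF]] [psi [R HR] [[G hG G0] HG]].
exists (fun F => phi F * psi F).
  by exists (Q * R) => F' hF'; rewrite mevalM HQ // HR.
split; last first.
  by move=> F' hF'; rewrite mulf_eq0 negb_or => /andP[? ?]; split; auto.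
pose l i : {poly K} := (family_coords F i)%:P + (family_coords G i - family_coords F i) *: 'X.
have ev (T : {mpoly K[_]}) t : (mmap polyC l T).[t] =
    T.@[family_coords (fun i => F i + t *: (G i - F i))].
  rewrite horner_mmap; apply: meval_eq => i; rewrite family_coords_line /l.
  by rewrite hornerD hornerC hornerZ hornerX mulrC.
have nz (T : {mpoly K[_]}) t :
    T.@[family_coords (fun i => F i + t *: (G i - F i))] != 0 -> mmap polyC l T != 0.
  by apply: contra_neq => T0; rewrite -ev T0 horner0.
(* The first restriction is nonzero at t = 0, where the line meets [F], the second at t = 1, where
   it meets [G]. *)
have [|t] := infinite_nonroot charK (p := mmap polyC l Q * mmap polyC l R).
  rewrite mulf_neq0 //.
    apply: (nz _ 0); rewrite -HQ; last exact: hom_line.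
    rewrite HQ ?(meval_eq _ (family_coords_line F G 0)); last exact: hom_line.
    by under meval_eq do rewrite mul0r addr0; rewrite -HQ.
  apply: (nz _ 1); rewrite (meval_eq _ (family_coords_line F G 1)).
  by under meval_eq do rewrite mul1r addrC subrK; rewrite -HR.
rewrite hornerM !ev => t0.
exists (fun i => F i + t *: (G i - F i)); first exact: hom_line.
by rewrite HQ ?HR //; exact: hom_line.
Qed.

Lemma generically_imp Pr1 Pr2 : generically Pr1 ->
  (forall F, homs F -> Pr1 F -> Pr2 F) -> generically Pr2.
Proof.
by move=> [phi pphi [H1 H2]] H; exists phi => //; split=> // F hF /H2; auto.
Qed.

Lemma polyfunC c : polyfun (fun => c).
Proof. by exists c%:MP => F _; rewrite mevalC. Qed.

Lemma polyfunD phi psi :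
  polyfun phi -> polyfun psi -> polyfun (fun F => phi F + psi F).
Proof.
by move=> [P HP] [Q HQ]; exists (P + Q) => F hF; rewrite mevalD HP ?HQ.
Qed.

Lemma polyfunM phi psi :
  polyfun phi -> polyfun psi -> polyfun (fun F => phi F * psi F).
Proof.
by move=> [P HP] [Q HQ]; exists (P * Q) => F hF; rewrite mevalM HP ?HQ.
Qed.

Lemma polyfun_sum (I : Type) (s : seq I) (P : pred I) phi :
  (forall i, polyfun (phi i)) -> polyfun (fun F => \sum_(i <- s | P i) phi i F).
Proof.
move=> H; elim: s => [|i s IH].
  by have [Q HQ] := polyfunC 0; exists Q => F /HQ <-; rewrite big_nil.
have [Q HQ] := polyfunD (H i) IH; have [R HR] := IH.
by case Pi: (P i); [exists Q|exists R] => F hF; rewrite big_cons Pi; auto.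
Qed.

Lemma polyfun_prod (I : Type) (s : seq I) (P : pred I) phi :
  (forall i, polyfun (phi i)) -> polyfun (fun F => \prod_(i <- s | P i) phi i F).
Proof.
move=> H; elim: s => [|i s IH].
  by have [Q HQ] := polyfunC 1; exists Q => F /HQ <-; rewrite big_nil.
have [Q HQ] := polyfunM (H i) IH; have [R HR] := IH.
by case Pi: (P i); [exists Q|exists R] => F hF; rewrite big_cons Pi; auto.
Qed.

Lemma coord_blkE d (f : S) m (hm : (mdeg m < d.+1)%N) :
  exists j : 'I_(nmon d), forall f : S, coord_blk f j = f@_m.
Proof.
by exists (enum_rank (BMultinom hm)) => g; rewrite /coord_blk enum_rankK.
Qed.

Lemma polyfun_coef i m : polyfun (fun F => (F i)@_m).
Proof.
have [/eqP dm|ndm] := boolP (mdeg m == ds i); last first.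
  by exists 0 => F hF; rewrite meval0 (dhomog_nemf_coeff (hF i)).
have hm : (mdeg m < (ds i).+1)%N by rewrite dm.
move: i {dm} hm; apply: ord3P => hm; have [j Hj] := coord_blkE 0 hm.
- exists 'X_(lshift _ (lshift _ j)) => F _; rewrite mevalXU /family_coords /coords.
  by rewrite -!/(unsplit (inl _)) !unsplitK Hj.
- exists 'X_(lshift _ (rshift _ j)) => F _; rewrite mevalXU /family_coords /coords.
  by rewrite -!/(unsplit (inl _)) -!/(unsplit (inr _)) !unsplitK Hj.
- exists 'X_(rshift _ j) => F _; rewrite mevalXU /family_coords /coords.
  by rewrite -!/(unsplit (inr _)) !unsplitK Hj.
Qed.

Lemma polyfun_coefM (h : S) i m : polyfun (fun F => (h * F i)@_m).
Proof.
pose I : finType := ('X_{1..3 < (mdeg m).+1} * 'X_{1..3 < (mdeg m).+1})%type.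
pose c F (k : I) : K :=
  h@_k.1 * (F i)@_k.2.
have [|Q HQ] := polyfun_sum (index_enum I) (fun k : I => m == (k.1 + k.2)%MM)
  (phi := fun k F => c F k).
  by move=> k; apply: polyfunM; [apply: polyfunC|apply: polyfun_coef].
by exists Q => F hF; rewrite mcoeffM HQ.
Qed.

(** With a right inverse [B] of [A F0] fixed, the determinant of [A F *m B] is polynomial in the
    coefficients of [F] and equals 1 at [F0]; where it is nonzero, [A F] has a right inverse. *)
Lemma generically_row_free r n (A : ('I_3 -> S) -> 'M[K]_(r, n)) F0 :
  (forall i j, polyfun (fun F => A F i j)) -> homs F0 -> row_free (A F0) ->
  generically (fun F => row_free (A F)).
Proof.
move=> pA hF0 /row_freeP[B AB].
exists (fun F => \det (A F *m B)).
  have [] : polyfun (fun F => \sum_(s : 'S_r) (-1) ^+ s *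
      \prod_i \sum_j A F i j * B j (s i)).
    apply: polyfun_sum => s; apply: polyfunM; first exact: polyfunC.
    apply: polyfun_prod => i; apply: polyfun_sum => j.
    by apply: polyfunM => //; apply: polyfunC.
  move=> Q HQ; exists Q => F hF; rewrite -HQ // /determinant.
  apply: eq_bigr => s _; congr (_ * _); apply: eq_bigr => i _.
  by rewrite mxE.
split; first by exists F0; rewrite // AB det1 oner_neq0.
move=> F hF; rewrite -unitfE -unitmxE => U.
by apply/row_freeP; exists (B *m invmx (A F *m B)); rewrite mulmxA mulmxV.
Qed.

End Generic.

(** * Leading monomials and ranks *)

Section Leads.
Variable K : fieldType.
Notation S := {mpoly K[3]}.

Lemma mdeg3 (m : 'X_{1..3}) : mdeg m = (m i0 + m i1 + m i2)%N.
Proof.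
rewrite mdegE !big_ord_recl big_ord0 addn0 addnA.
by congr (m _ + m _ + m _)%N; apply/val_inj.
Qed.

Definition mons d : seq 'X_{1..3} :=
  [seq m <- [seq val x | x <- enum {: 'X_{1..3 < d.+1}}] | mdeg m == d].

Lemma mem_mons d m : (m \in mons d) = (mdeg m == d).
Proof.
rewrite mem_filter; case: eqP => //= dm.
have hm : (mdeg m < d.+1)%N by rewrite dm.
by apply/mapP; exists (BMultinom hm); rewrite ?mem_enum.
Qed.

Lemma mons_uniq d : uniq (mons d).
Proof. by rewrite filter_uniq // map_inj_uniq ?enum_uniq //; exact: val_inj. Qed.

(* On monomials of degree d, a larger revlex monomial has a smaller key. *)
Definition key d (m : 'X_{1..3}) : nat := (m i2 * d.+1 + m i1)%N.

Lemma key_inj d m m' : mdeg m = d -> mdeg m' = d -> key d m = key d m' -> m = m'.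
Proof.
rewrite !mdeg3 /key => dm dm' e.
have e2 : m i2 = m' i2 by nia.
have e1 : m i1 = m' i1 by nia.
by apply/mnmP; apply: ord3P => //; lia.
Qed.

Lemma revlex_gtE d a b : mdeg a = d -> mdeg b = d ->
  revlex_gt a b = (key d a < key d b)%N.
Proof.
move=> da db; rewrite /revlex_gt da db ltnn eqxx /=.
have := da; have := db; rewrite !mdeg3 /key => db3 da3.
apply/existsP/idP => [[j /andP[lt_ab /forallP H]]|lt_ab].
  have H1 (k : 'I_3) : (j < k)%N -> a k = b k.
    by move=> jk; apply/eqP; move/implyP: (H k) => /(_ jk).
  move: j lt_ab H1 {H}; apply: ord3P => lt_ab H1.
  - have := H1 i1 isT; have := H1 i2 isT; lia.
  - have := H1 i2 isT; lia.
  - nia.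
have [e2|n2] := eqVneq (a i2) (b i2).
  exists i1; apply/andP; split; first by nia.
  by apply/forallP; apply: ord3P => //=; rewrite e2.
exists i2; apply/andP; split; first by nia.
by apply/forallP; apply: ord3P.
Qed.

Definition lin (V : S -> Prop) : Prop :=
  V 0 /\ forall c g h, V g -> V h -> V (c *: g + h).

Lemma lin_sum V r (a : 'I_r -> K) (g : 'I_r -> S) :
  lin V -> (forall i, V (g i)) -> V (\sum_i a i *: g i).
Proof.
move=> [V0 VD] Vg; elim/big_rec: _ => // i x _ Vx; exact: VD.
Qed.

(* The projection of [V] to the coordinates in [T] has rank at least [r]. *)
Definition ind_ge (V : S -> Prop) (T : pred 'X_{1..3}) (r : nat) : Prop :=
  exists2 g : 'I_r -> S, forall i, V (g i) &
    forall a : 'I_r -> K, (forall m, T m -> (\sum_i a i *: g i)@_m = 0) ->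
    forall i, a i = 0.

Lemma mcoeff_sumZ r (a : 'I_r -> K) (g : 'I_r -> S) m :
  (\sum_i a i *: g i)@_m = \sum_i a i * (g i)@_m.
Proof. by rewrite raddf_sum; apply: eq_bigr => i _; rewrite /= mcoeffZ. Qed.

Lemma left_kernel r n (M : 'I_r -> 'I_n -> K) : (n < r)%N ->
  exists2 a : 'I_r -> K, (exists i, a i != 0) & forall j, \sum_i a i * M i j = 0.
Proof.
move=> lt_nr; pose A := \matrix_(i, j) M i j.
have : kermx A != 0.
  by rewrite kermx_eq0 /row_free neq_ltn (leq_ltn_trans (rank_leq_col A)).
case/rowV0Pn => v; rewrite sub_kermx => /eqP vA /rV0Pn[i vi].
exists (v 0) => [|j]; first by exists i.
move/matrixP: vA => /(_ 0 j); rewrite !mxE => E; rewrite -[RHS]E.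
by apply: eq_bigr => k _; rewrite mxE.
Qed.

(** Otherwise [left_kernel] gives a nontrivial combination of the [r] elements vanishing on [s],
    hence on [T], against independence. *)
Lemma ind_le V T r (s : seq 'X_{1..3}) : lin V -> ind_ge V T r ->
  (forall g, V g -> (forall m, m \in s -> g@_m = 0) -> forall m, T m -> g@_m = 0) ->
  (r <= size s)%N.
Proof.
move=> linV [g Vg indg] H; rewrite leqNgt; apply/negP => lt_sr.
have [a [i ai] Ha] := left_kernel (fun i (j : 'I_(size s)) => (g i)@_(nth 0%MM s j)) lt_sr.
case/eqP: ai; apply: indg; apply: H; first exact: lin_sum.
move=> m ms; have lt_m : (index m s < size s)%N by rewrite index_mem.
have := Ha (Ordinal lt_m); rewrite /= nth_index //.
by rewrite mcoeff_sumZ.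
Qed.

Lemma ind_mono V T r r' : (r' <= r)%N -> ind_ge V T r -> ind_ge V T r'.
Proof.
move=> le_r.
pose e : 'I_r' -> 'I_r := widen_ord le_r.
have inj_e : injective e by move=> i j /(congr1 val) /= ?; apply/val_inj.
move=> [g Vg indg]; exists (g \o e) => [i|a Ha i]; first exact: Vg.
(* The extension of [a] by zero along [e]. *)
pose b (j : 'I_r) := \sum_(k | e k == j) a k.
have -> : a i = b (e i).
  by rewrite /b (eq_bigl (pred1 i)) ?big_pred1_eq // => k; rewrite inj_eq.
apply: indg => m Tm; rewrite -[RHS](Ha m Tm); congr (_@_m).
rewrite [RHS](partition_big e xpredT) //; apply: eq_bigr => j _.
by rewrite scaler_suml; apply: eq_bigr => k /eqP <-.
Qed.

(** The rank equals the number of degree-d monomials in [T], so the coefficient matrix is square and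
    invertible, and one can solve for the prescribed coordinates of [p]. *)
Lemma ind_surj d V T : lin V -> (forall g, V g -> g \is d.-homog) ->
  ind_ge V T (count T (mons d)) -> forall p : S,
  exists2 g, V g & forall m, mdeg m = d -> T m -> (p - g)@_m = 0.
Proof.
move=> linV homV [g Vg indg] p.
set n := count T (mons d) in g Vg indg.
pose s := [seq m <- mons d | T m].
have ss : size s = n by rewrite size_filter.
pose M : 'M[K]_n := \matrix_(i, j) (g i)@_(nth 0%MM s j).
have free : row_free M.
  rewrite -kermx_eq0; apply: contraT => /rowV0Pn[v]; rewrite sub_kermx => /eqP vM.
  case/rV0Pn => i /eqP []; apply: indg => m Tm.
  have [/eqP dm|dm] := boolP (mdeg m == d); last first.
    by rewrite (dhomog_nemf_coeff _ dm) // homV //; exact: lin_sum.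
  have ms : m \in s by rewrite mem_filter Tm mem_mons dm eqxx.
  have lt_m : (index m s < n)%N by rewrite -ss index_mem.
  move/matrixP: vM => /(_ 0 (Ordinal lt_m)); rewrite !mxE mcoeff_sumZ => E; rewrite -[RHS]E.
  by apply: eq_bigr => k _; rewrite !mxE /= nth_index.
pose v : 'rV[K]_n := (\row_j p@_(nth 0%MM s j)) *m invmx M.
exists (\sum_i v 0 i *: g i); first exact: lin_sum.
move=> m dm Tm; have ms : m \in s by rewrite mem_filter Tm mem_mons dm eqxx.
have lt_m : (index m s < n)%N by rewrite -ss index_mem.
have vM : v *m M = \row_j p@_(nth 0%MM s j).
  by rewrite /v -mulmxA mulVmx ?mulmx1 // -row_free_unit.
move/matrixP: vM => /(_ 0 (Ordinal lt_m)); rewrite !mxE /= nth_index // => vm.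
rewrite mcoeffB mcoeff_sumZ -vm; apply/eqP; rewrite subr_eq0; apply/eqP.
by apply: eq_bigr => k _; rewrite !mxE /= nth_index.
Qed.

Definition leads d (g : S) (m : 'X_{1..3}) : Prop :=
  [/\ mdeg m = d, g@_m != 0 &
      forall m', mdeg m' = d -> (key d m' < key d m)%N -> g@_m' = 0].

(** Deciding existence classically yields a boolean predicate, so that leading monomials can be
    filtered and counted. *)
Definition lm (V : S -> Prop) d m : bool :=
  if excluded_middle_informative (exists2 g, V g & leads d g m) then true else false.

Lemma lmP V d m : reflect (exists2 g, V g & leads d g m) (lm V d m).
Proof. by rewrite /lm; case: excluded_middle_informative => H; constructor. Qed.

Definition lms V d N := [seq m <- mons d | lm V d m && (key d m < N)%N].

Definition rho V d N := size (lms V d N).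

Lemma mem_lms V d N m : (m \in lms V d N) = lm V d m && (key d m < N)%N.
Proof.
by rewrite mem_filter mem_mons; case: lmP => // -[g _ [-> _ _]]; rewrite eqxx andbT.
Qed.

Lemma lms_uniq V d N : uniq (lms V d N).
Proof. by rewrite filter_uniq ?mons_uniq. Qed.

Lemma ex_leads d g m : mdeg m = d -> g@_m != 0 ->
  exists m', leads d g m' /\ (key d m' <= key d m)%N.
Proof.
elim/ltn_ind: {m}(key d m) {-2}m (erefl (key d m)) => k IH m ek dm gm.
have [[m' [dm' lt_k gm']]|H] := classic (exists m', [/\ mdeg m' = d,
    (key d m' < key d m)%N & g@_m' != 0]).
  have lt' : (key d m' < k)%N by rewrite -ek.
  have [m'' [lm'' le_m'']] := IH _ lt' m' erefl dm' gm'.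
  by exists m''; split => //; exact: leq_trans (ltnW lt_k).
exists m; split => //; split => // m' dm' lt_k; apply/eqP; apply: contraT => gm'.
by case: H; exists m'.
Qed.

(** An element of [V] vanishing at every leading monomial of key below [N] vanishes at all keys
    below [N], since otherwise its own leading monomial would be one of them. So these monomials
    bound the rank. *)
Lemma rho_ge V d N r : lin V -> (forall g, V g -> g \is d.-homog) ->
  ind_ge V (fun m => key d m < N)%N r -> (r <= rho V d N)%N.
Proof.
move=> linV homV /ind_le -> // g Vg Hg m Tm; apply/eqP; apply: contraT => gm.
have [/eqP dm|dm] := boolP (mdeg m == d); last first.
  by rewrite (dhomog_nemf_coeff _ dm) ?eqxx ?homV in gm.
have [m' [lm' le_m']] := ex_leads dm gm; case: (lm') => _ /eqP [].
apply: Hg; rewrite mem_lms (leq_ltn_trans le_m' Tm) andbT.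
by apply/lmP; exists g.
Qed.

(** The system is triangular: at [u i] only elements whose leading monomial has key at most that of
    [u i] contribute, and those of smaller key have coefficient zero by induction. *)
Lemma leads_ind d N r (g : 'I_r -> S) (u : 'I_r -> 'X_{1..3}) :
  injective u -> (forall i, leads d (g i) (u i)) -> forall a : 'I_r -> K,
  (forall m, mdeg m = d -> (key d m < N)%N -> (\sum_i a i *: g i)@_m = 0) ->
  forall i, (key d (u i) < N)%N -> a i = 0.
Proof.
move=> inj_u lead a Ha i.
elim/ltn_ind: {i}(key d (u i)) {-2}i (erefl (key d (u i))) => k IH i ek lt_N.
have [du gu _] := lead i; have := Ha _ du lt_N => /eqP.
rewrite mcoeff_sumZ (bigD1 i) //= big1 => [|j ne_ji].
  by rewrite addr0 mulf_eq0 (negPf gu) orbF => /eqP.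
have [dj _ Hj] := lead j.
case: (ltngtP (key d (u i)) (key d (u j))) => [lt|lt|e].
- by rewrite Hj ?mulr0.
- by rewrite (IH _ _ j erefl) ?mul0r -?ek //; exact: ltn_trans lt_N.
- by rewrite (inj_u _ _ (key_inj du dj e)) eqxx in ne_ji.
Qed.

Lemma leads_family V d u : (forall m, m \in u -> lm V d m) ->
  exists g : 'I_(size u) -> S,
    forall i, V (g i) /\ leads d (g i) (nth 0%MM u i).
Proof.
move=> Hu; have [|g Hg] := @fin_all_exists 'I_(size u) (fun=> S)
  (fun i h => V h /\ leads d h (nth 0%MM u i)); last by exists g.
by move=> i; have /Hu/lmP[g Vg lg] := mem_nth 0%MM (ltn_ord i); exists g.
Qed.

Lemma nth_inj (u : seq 'X_{1..3}) : uniq u ->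
  injective (fun i : 'I_(size u) => nth 0%MM u i).
Proof. by move=> uu i j /eqP; rewrite nth_uniq // => /eqP ?; apply/val_inj. Qed.

(** Elements realising the distinct leading monomials are independent by [leads_ind]. With [rho_ge]
    this identifies [rho] with the rank of the projection to keys below [N]. *)
Lemma ind_rho V d N : ind_ge V (fun m => key d m < N)%N (rho V d N).
Proof.
have Hl m : m \in lms V d N -> lm V d m by rewrite mem_lms => /andP[].
have [g Hg] := leads_family Hl; exists g => [i|a Ha i]; first by case: (Hg i).
apply: (leads_ind (nth_inj (lms_uniq V d N)) (fun i => proj2 (Hg i)) (N := N)) => [m _|].
  exact: Ha.
by have := mem_nth 0%MM (ltn_ord i); rewrite mem_lms => /andP[].
Qed.

End Leads.

(** * Graded pieces of the ideal, its initial ideal, and generic ranks *)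

Section Ideals.
Variables (K : fieldType) (ds : 'I_3 -> nat).
Notation S := {mpoly K[3]}.
Notation homs := (@homs K ds).

Lemma coef_mulX (p : S) k m : (p * 'X_[k])@_m = if (k <= m)%MM then p@_(m - k) else 0.
Proof.
case: ifP => km; first by rewrite -{1}(submK km) addmC mcoeffMX.
apply/eqP; rewrite mcoeff_eq0; apply: contraFN km.
by rewrite (perm_mem (msuppMX p k)) => /mapP[m' _ ->]; exact: lem_addr.
Qed.

Lemma coef_pihomog d (p : S) m :
  (pihomog mdeg d p)@_m = if mdeg m == d then p@_m else 0.
Proof.
elim/mpolyind: p => [|c k p _ _ IH]; first by rewrite raddf0 !mcoeff0 if_same.
rewrite linearP /= mcoeffD mcoeffZ IH pihomogX (fun_if (mcoeff m)) mcoeff0.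
rewrite mcoeffD mcoeffZ mcoeffX.
have [<-|ne] := eqVneq k m; first by case: ifP; rewrite // mulr0 addr0.
by rewrite if_same !mulr0 !add0r.
Qed.

(* [hshift d e h]: [h] is homogeneous of degree d - e, and zero when d < e. *)
Definition hshift d e (h : S) : Prop := forall m, h@_m != 0 -> (mdeg m + e)%N = d.

Lemma hshift0 d e : hshift d e 0.
Proof. by move=> m; rewrite mcoeff0 eqxx. Qed.

Lemma hshiftP d e c g h : hshift d e g -> hshift d e h -> hshift d e (c *: g + h).
Proof.
move=> Hg Hh m; rewrite mcoeffD mcoeffZ.
have [->|/Hg //] := eqVneq (g@_m) 0; rewrite mulr0 add0r; exact: Hh.
Qed.

Lemma hshiftD d e g h : hshift d e g -> hshift d e h -> hshift d e (g + h).
Proof. by move=> Hg Hh; rewrite -[g]scale1r; exact: hshiftP. Qed.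

Lemma hshift_homog d e h : hshift d e h -> (e <= d)%N -> h \is (d - e).-homog.
Proof.
move=> Hh _; apply/dhomogP => m; rewrite mcoeff_msupp => /Hh <-.
by rewrite addnK.
Qed.

Lemma homog_hshift d (h : S) e : h \is d.-homog -> hshift (d + e) e h.
Proof.
move=> /dhomogP Hh m; rewrite -mcoeff_msupp => /Hh ->; done.
Qed.

Lemma hshift_eq0 d e h : hshift d e h -> (d < e)%N -> h = 0.
Proof.
move=> Hh lt; apply/mpolyP => m; rewrite mcoeff0; apply/eqP.
by apply: contraT => /Hh; lia.
Qed.

Lemma hshift_homogM d e h f : hshift d e h -> f \is e.-homog -> h * f \is d.-homog.
Proof.
move=> Hh hf; case: (leqP e d) => [le_ed|lt]; last by rewrite (hshift_eq0 Hh lt) mul0r dhomog0.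
by rewrite -(subnK le_ed); apply: dhomogM => //; exact: hshift_homog.
Qed.

Lemma hshiftM d e k f g : hshift d e f -> hshift e k g -> hshift d k (f * g).
Proof.
move=> Hf Hg m; case: (leqP e d) => [le_ed|lt]; last first.
  by rewrite (hshift_eq0 Hf lt) mul0r mcoeff0 eqxx.
case: (leqP k e) => [le_ke|lt]; last by rewrite (hshift_eq0 Hg lt) mulr0 mcoeff0 eqxx.
have := dhomogM (hshift_homog Hf le_ed) (hshift_homog Hg le_ke).
by move/dhomogP => H; rewrite -mcoeff_msupp => /H ->; lia.
Qed.

(* Degree-d part of the ideal generated by the [F i] with [b i]. *)
Definition slice (b : pred 'I_3) d (F : 'I_3 -> S) (g : S) : Prop :=
  exists2 h : 'I_3 -> S, forall i, hshift d (ds i) (h i) & g = \sum_(i | b i) h i * F i.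

Lemma slice_lin b d F : lin (slice b d F).
Proof.
split; first by exists (fun=> 0) => [i|]; [exact: hshift0|rewrite big1 // => i; rewrite mul0r].
move=> c g g' [h Hh ->] [h' Hh' ->]; exists (fun i => c *: h i + h' i) => [i|].
  exact: hshiftP.
rewrite scaler_sumr -big_split; apply: eq_bigr => i _.
by rewrite mulrDl scalerAl.
Qed.

Lemma slice_homog b d F g : homs F -> slice b d F g -> g \is d.-homog.
Proof.
move=> hF [h Hh ->]; apply: rpred_sum => i _; exact: hshift_homogM (Hh i) (hF i).
Qed.

Lemma slice_mulX b d F g k :
  slice b d F g -> slice b (d + mdeg k) F (g * 'X_[k]).
Proof.
move=> [h Hh ->]; exists (fun i => h i * 'X_[k]) => [i m|].
  rewrite coef_mulX; case: ifP => [km|_]; last by rewrite eqxx.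
  by move/Hh => <-; rewrite -{1}(submK km) mdegD; lia.
by rewrite mulr_suml; apply: eq_bigr => i _; rewrite mulrAC.
Qed.

Lemma pihomogM d e (h f : S) : f \is e.-homog ->
  pihomog mdeg d (h * f) = (if (e <= d)%N then pihomog mdeg (d - e) h else 0) * f.
Proof.
move=> hf; elim/mpolyind: h => [|c m p _ _ IH].
  by rewrite !raddf0 if_same mul0r raddf0.
rewrite mulrDl linearD /= IH -scalerAl linearZ /=.
have hm : 'X_[m] * f \is (mdeg m + e).-homog.
  by rewrite dhomogM // dhomogX.
case: (leqP e d) => [le_ed|lt_de]; last first.
  by rewrite !mul0r (pihomog_ne0 _ hm) ?scaler0 ?addr0 //; lia.
rewrite linearD linearZ /= mulrDl -scalerAl pihomogX; congr (_ *: _ + _).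
case: eqP => dm; first by rewrite pihomog_dE // -(subnK le_ed) -dm.
rewrite mul0r (pihomog_ne0 _ hm) //; apply/eqP => E; apply: dm.
by rewrite -E addnK.
Qed.

(** Each coefficient is replaced by its component of degree d - d_i, or by zero when d < d_i. *)
Lemma slice_ideal d F (h : 'I_3 -> S) : homs F ->
  slice predT d F (pihomog mdeg d (\sum_i h i * F i)).
Proof.
move=> hF; exists (fun i => if (ds i <= d)%N then pihomog mdeg (d - ds i) (h i) else 0).
  move=> i m; case: leqP => le; last by rewrite mcoeff0 eqxx.
  by rewrite coef_pihomog; case: (eqVneq (mdeg m)) => [->|_]; rewrite ?subnK // eqxx.
by rewrite raddf_sum; apply: eq_bigr => i _ /=; rewrite (pihomogM _ _ (hF i)).
Qed.

Lemma key_lt d a b : mdeg a = d -> mdeg b = d ->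
  (key d a < key d b)%N = (a i2 < b i2)%N || ((a i2 == b i2) && (a i1 < b i1)%N).
Proof.
rewrite !mdeg3 /key => da db.
case: (ltngtP (a i2) (b i2)) => [lt|lt|->] /=; last by rewrite ltn_add2l.
  by nia.
by apply/negbTE; rewrite -leqNgt; nia.
Qed.

Lemma mdeg_addI (m k : 'X_{1..3}) d : mdeg (k + m) = (d + mdeg k)%N -> mdeg m = d.
Proof. by rewrite mdegD; lia. Qed.

(** A monomial factor shifts all exponents of x_3 and of x_2 by the same amounts, and within one
    degree these exponents decide the order. *)
Lemma leads_mulX d (g : S) m k : leads d g m -> leads (d + mdeg k) (g * 'X_[k]) (k + m).
Proof.
move=> [dm gm Hm]; split; first by rewrite mdegD dm addnC.
  by rewrite mcoeffMX.
move=> m' dm' lt; rewrite coef_mulX; case: ifP => // km; apply: Hm.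
  by apply: (@mdeg_addI _ k); rewrite addmC submK.
set l := (m' - k)%MM; have em : m' = (l + k)%MM by rewrite submK.
rewrite em in lt dm'.
have dl' : mdeg l = d by apply: (@mdeg_addI _ k); rewrite addmC.
have dk : mdeg (k + m)%MM = (d + mdeg k)%N by rewrite mdegD dm addnC.
move: lt; rewrite (key_lt dm' dk) (key_lt dl' dm) !mnmDE.
by lia.
Qed.

Lemma lm_mulX b d F m k :
  lm (slice b d F) d m -> lm (slice b (d + mdeg k) F) (d + mdeg k) (k + m).
Proof.
by case/lmP=> g Vg lg; apply/lmP; exists (g * 'X_[k]);
  [exact: slice_mulX|exact: leads_mulX].
Qed.

Lemma lm_le b F m m' : (m <= m')%MM ->
  lm (slice b (mdeg m) F) (mdeg m) m -> lm (slice b (mdeg m') F) (mdeg m') m'.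
Proof.
move=> le_m /(@lm_mulX _ _ _ _ (m' - m)%MM).
by rewrite -mdegD addmC submK // => le_m; rewrite addmC submK.
Qed.

Definition gens F : S -> Prop := fun q => q = F i0 \/ q = F i1 \/ q = F i2.

Lemma ideal_gensP F g : ideal_gen (gens F) g <->
  exists h : 'I_3 -> S, g = \sum_i h i * F i.
Proof.
split=> [[k [h [G [HG ->]]]]|[h ->]]; last first.
  exists 3, h, F; split=> //; apply: ord3P; rewrite /gens; tauto.
elim/big_rec: _ => [|i x _ [u ->]].
  by exists (fun=> 0); rewrite big1 // => i; rewrite mul0r.
suff [j ->] : exists j, G i = F j.
  exists (fun l => (if l == j then h i else 0) + u l).
  rewrite (eq_bigr _ (fun l _ => mulrDl _ _ _)) big_split; congr (_ + _) => /=.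
  by rewrite (bigD1 j) //= eqxx big1 ?addr0 // => l /negPf ->; rewrite mul0r.
by case: (HG i) => [|[]] ->; [exists i0|exists i1|exists i2].
Qed.

(** This reduces the initial ideal to graded pieces. A monomial of the initial ideal is divisible by
    the leading monomial of some element of the ideal; the homogeneous component of that element in
    the degree of this leading monomial has the same leading monomial, and [lm_le] passes to
    multiples. *)
Lemma initial_idealP F m : homs F ->
  (initial_ideal (ideal_gen (gens F)) 'X_[m] <->
   lm (slice predT (mdeg m) F) (mdeg m) m).
Proof.
move=> hF; split; last first.
  case/lmP => g Vg [_ gm Hm]; exists 1, (fun=> 1), (fun=> 'X_[m]).
  split=> [_|]; last by rewrite big_ord1 mul1r.
  exists g, m; split; last split=> //.
    by case: Vg => h _ ->; apply/ideal_gensP; exists h.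
  split; first by rewrite mcoeff_msupp.
  move=> m' sm' ne_m.
  have dm' : mdeg m' = mdeg m by move/dhomogP: (slice_homog hF Vg) => /(_ _ sm').
  rewrite (revlex_gtE (erefl _) dm') ltn_neqAle; apply/andP; split.
    by apply: contra ne_m => /eqP e; rewrite (key_inj _ dm' e).
  rewrite leqNgt; apply/negP => /(Hm _ dm') /eqP.
  by rewrite mcoeff_eq0 sm'.
move=> [k [h [G [HG /(congr1 (mcoeff m))]]]].
rewrite mcoeffX eqxx raddf_sum /= => E.
have [i hi] : exists i, (h i * G i)@_m != 0.
  apply: NNPP => H; case/eqP: (oner_neq0 K); apply: (etrans E); rewrite big1 // => i _.
  by apply/eqP; apply: contraT => hi; case: H; exists i.
have [g [m0 [/ideal_gensP[u eg] [[sm0 lm0] eG]]]] := HG i.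
move: hi; rewrite eG coef_mulX; case: ifP => [le_m _|]; last by rewrite eqxx.
apply: lm_le le_m _; apply/lmP; exists (pihomog mdeg (mdeg m0) g).
  by rewrite eg; exact: slice_ideal.
split=> // [|m' dm' lt]; first by rewrite coef_pihomog eqxx -mcoeff_msupp.
rewrite coef_pihomog dm' eqxx; apply/eqP; rewrite mcoeff_eq0; apply/negP => sm'.
have ne : m' != m0 by apply/eqP => e; rewrite e ltnn in lt.
by have := lm0 _ sm' ne; rewrite (revlex_gtE (erefl _) dm'); lia.
Qed.

(** The independent elements at [F0] are written as combinations of the generators. Keeping the
    coefficients [h] and letting [F] vary gives a matrix with entries polynomial in [F], to which
    [generically_row_free] applies. *)
Lemma generically_ind_ge b d T r F0 : homs F0 -> ind_ge (slice b d F0) T r ->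
  generically ds (fun F => ind_ge (slice b d F) T r).
Proof.
move=> hF0 [g Vg indg].
have [h Hh] : exists h : 'I_r -> 'I_3 -> S, forall j,
    (forall i, hshift d (ds i) (h j i)) /\ g j = \sum_(i | b i) h j i * F0 i.
  have [|h Hh] := @fin_all_exists 'I_r (fun=> 'I_3 -> S) (fun j h =>
    (forall i, hshift d (ds i) (h i)) /\ g j = \sum_(i | b i) h i * F0 i).
    by move=> j; case: (Vg j) => h; exists h.
  by exists h.
pose G F j := \sum_(i | b i) h j i * F i.
pose s := [seq m <- mons d | T m].
pose A F : 'M[K]_(r, size s) := \matrix_(j, l) (G F j)@_(nth 0%MM s l).
have VG F j : slice b d F (G F j) by exists (h j) => //; case: (Hh j).
have freeP F : homs F -> row_free (A F) <->
    (forall a : 'I_r -> K, (forall m, T m -> (\sum_i a i *: G F i)@_m = 0) ->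
     forall i, a i = 0).
  move=> hF; split=> [free a Ha i|H].
    have : (\row_j a j) *m A F = 0.
      apply/rowP => l; rewrite !mxE.
      have := mem_nth 0%MM (ltn_ord l); rewrite mem_filter => /andP[/Ha E _].
      rewrite -[RHS]E mcoeff_sumZ; apply: eq_bigr => j _; by rewrite !mxE.
    by move/eqP; rewrite mulmx_free_eq0 // => /eqP /rowP/(_ i); rewrite !mxE.
  rewrite -kermx_eq0; apply: contraT => /rowV0Pn[v]; rewrite sub_kermx => /eqP vA.
  case/rV0Pn => i /eqP []; apply: H => m Tm.
  have [/eqP dm|dm] := boolP (mdeg m == d); last first.
    rewrite (dhomog_nemf_coeff _ dm) //; apply: (slice_homog (b := b) hF).
    by apply: lin_sum => //; exact: slice_lin.
  have ms : m \in s by rewrite mem_filter Tm mem_mons dm eqxx.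
  have lt_m : (index m s < size s)%N by rewrite index_mem.
  move/matrixP: vA => /(_ 0 (Ordinal lt_m)); rewrite !mxE mcoeff_sumZ => E.
  by rewrite -[RHS]E; apply: eq_bigr => k _; rewrite !mxE /= nth_index.
have pA i j : polyfun ds (fun F => A F i j).
  have [|Q HQ] := @polyfun_sum K ds _ (index_enum 'I_3) b
    (fun k F => (h i k * F k)@_(nth 0%MM s j)).
    by move=> k; exact: polyfun_coefM.
  by exists Q => F hF; rewrite -HQ // mxE raddf_sum.
apply: generically_imp (generically_row_free pA hF0 _) _ => [|F hF free].
  apply/(freeP _ hF0) => a Ha; apply: indg => m /Ha E; rewrite -[RHS]E.
  by congr (_@_m); apply: eq_bigr => i _; rewrite (proj2 (Hh i)).
by exists (G F) => //; exact/(freeP _ hF).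
Qed.

(** The possible ranks are bounded by the number of monomials of degree d, so a largest one is
    attained by some family, hence generically. *)
Lemma generically_max_ind b d T : generically ds (fun F => forall F' r, homs F' ->
  ind_ge (slice b d F') T r -> ind_ge (slice b d F) T r).
Proof.
pose P r := exists2 F, homs F & ind_ge (slice b d F) T r.
have bnd r : P r -> (r <= size (mons d))%N.
  move=> [F hF] indF; apply: (ind_le (slice_lin b d F) indF) => g Vg Hg m _.
  have [/eqP dm|dm] := boolP (mdeg m == d); last first.
    by rewrite (dhomog_nemf_coeff _ dm) // (slice_homog hF Vg).
  by apply: Hg; rewrite mem_mons dm.
have P0 : P 0%N.
  exists (fun=> 0) => [i|]; first exact: dhomog0.
  by exists (fun=> 0) => [[]|a _ []].
have [r [[F hF indF] max_r]] : exists r, P r /\ forall r', P r' -> (r' <= r)%N.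
  pose p r : bool := if excluded_middle_informative (P r) then true else false.
  have pP r : reflect (P r) (p r).
    by rewrite /p; case: excluded_middle_informative => ?; constructor.
  have ex : exists r, p r by exists 0%N; apply/pP.
  have ub r : p r -> (r <= size (mons d))%N by move/pP/bnd.
  case: (ex_maxnP ex ub) => r /pP Pr max_r; exists r; split=> // r' /pP.
  exact: max_r.
apply: generically_imp (generically_ind_ge hF indF) _ => F1 hF1 ind1 F' r' hF' ind'.
by apply: ind_mono ind1; apply: max_r; exists F'.
Qed.

End Ideals.

(** * Shearing x_2 into x_2 + c x_1 *)

Section Wronskian.
Variables (K : fieldType) (charK : [pchar K] =i pred0).

Lemma coef_top (p q : {poly K}) m n : (size p <= m.+1)%N -> (size q <= n.+1)%N ->
  (p * q)`_(m + n) = p`_m * q`_n.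
Proof.
move=> sp sq; have lt_m : (m < (m + n).+1)%N by lia.
rewrite coefM (bigD1 (Ordinal lt_m)) //= addKn big1 ?addr0 // => j ne_j.
have ne : (j : nat) != m by apply: contra ne_j => /eqP e; apply/eqP/val_inj.
case: (ltngtP j m) ne => // lt _.
  by rewrite [q`__]nth_default ?mulr0 //; apply: leq_trans sq _; lia.
by rewrite nth_default ?mul0r //; exact: leq_trans lt.
Qed.

(** Multiplying by X gives x p' q = p x q', where x p' has coefficients i p_i. Comparing top
    coefficients yields deg p = deg q in characteristic zero. *)
Lemma wronskian_size (p q : {poly K}) :
  p != 0 -> q != 0 -> p^`() * q = p * q^`() -> size p = size q.
Proof.
move=> p0 q0 e.
have sp : (0 < size p)%N by rewrite size_poly_gt0.
have sq : (0 < size q)%N by rewrite size_poly_gt0.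
have coefX (r : {poly K}) i : ('X * r^`())`_i = r`_i *+ i.
  by rewrite coefXM; case: i => [|i] //=; rewrite ?mulr0n // coef_deriv.
have sizeX (r : {poly K}) : (size ('X * r^`())%R <= size r)%N.
  by apply/leq_sizeP => j le; rewrite coefX nth_default ?mul0rn.
have e' : ('X * p^`()) * q = p * ('X * q^`()).
  by rewrite mulrCA -e mulrA.
have := congr1 (fun r : {poly K} => r`_((size p).-1 + (size q).-1)) e'.
rewrite !coef_top ?prednK ?(leq_trans (sizeX _)) ?prednK //.
rewrite !coefX -!lead_coefE mulrnAr mulrnAl => /eqP.
wlog le : p q p0 q0 sp sq {e e'} / (size p <= size q)%N => [W|].
  case: (leqP (size p) (size q)) => [|/ltnW] le E; first exact: (W p q).
  by apply/esym/(W q p) => //; rewrite eq_sym [lead_coef q * _]mulrC.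
rewrite eq_sym -subr_eq0 -mulrnBr; last by lia.
rewrite -mulr_natr !mulf_eq0 !lead_coef_eq0 (negPf p0) (negPf q0) /=.
rewrite (proj1 (pcharf0P K) charK) => /eqP.
by move: sp sq le; move: (size p) (size q) => a b; lia.
Qed.

(** Subtracting from p the multiple of q with the same leading coefficient leaves a solution r of
    the same equation. If r were nonzero it would have the size of q, although its top coefficient
    has been cancelled. *)
Lemma wronskian_kernel (p q : {poly K}) :
  q != 0 -> p^`() * q = p * q^`() -> exists k, p = k *: q.
Proof.
move=> q0 e; have [->|p0] := eqVneq p 0; first by exists 0; rewrite scale0r.
pose k := lead_coef p / lead_coef q; exists k; apply/eqP; rewrite -subr_eq0.
set r := p - _; apply: contraT => r0.
have er : r^`() * q = r * q^`().
  by rewrite derivB derivZ !mulrBl e -!scalerAl [q^`() * q]mulrC.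
have spq := wronskian_size p0 q0 e; have srq := wronskian_size r0 q0 er.
have sq : (0 < size q)%N by rewrite size_poly_gt0.
suff : (size r <= (size q).-1)%N by rewrite srq; lia.
apply/leq_sizeP => j; rewrite leq_eqVlt => /orP[/eqP <-|lt].
  rewrite coefB coefZ -lead_coefE -spq -lead_coefE /k divfK ?subrr //.
  by rewrite lead_coef_eq0.
have le : (size q <= j)%N by rewrite -(prednK sq).
by rewrite coefB coefZ !nth_default ?spq ?mulr0 ?subr0.
Qed.

(* Induction step: replacing h_i by the Wronskian h_i' h_0 - h_i h_0' lowers
   both the dimension and the vanishing order at c by one. *)
Lemma generic_vanishing_order r (h : 'I_r -> {poly K}) :
  (forall a : 'I_r -> K, \sum_i a i *: h i = 0 -> forall i, a i = 0) ->
  exists2 B : {poly K}, B != 0 & forall c, B.[c] != 0 ->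
    forall a : 'I_r -> K, ('X - c%:P) ^+ r %| \sum_i a i *: h i ->
    forall i, a i = 0.
Proof.
elim: r h => [|r IH] h ind_h; first by exists 1 => [|c _ a _ []//]; exact: oner_neq0.
pose h0 := h ord0.
have h00 : h0 != 0.
  apply/eqP => E; have := ind_h (fun i => (i == ord0)%:R).
  rewrite (bigD1 ord0) //= big1 => [|i /negPf ->]; last by rewrite scale0r.
  rewrite scale1r addr0 => /(_ E ord0) /eqP; by rewrite eqxx oner_eq0.
pose D (p : {poly K}) := p^`() * h0 - p * h0^`().
have DP c p q : D (c *: p + q) = c *: D p + D q.
  by rewrite /D derivD derivZ !mulrDl -!scalerAl scalerBr; ring.
have D0 : D 0 = 0 by rewrite /D deriv0 !mul0r subrr.
have Dh0 : D h0 = 0 by rewrite /D mulrC subrr.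
have Dsum n (a : 'I_n -> K) (g : 'I_n -> {poly K}) :
    D (\sum_i a i *: g i) = \sum_i a i *: D (g i).
  by elim/big_rec2: _ => [|i y1 y2 _ <-]; rewrite ?D0 ?DP.
have [|B B0 HB] := IH (fun i => D (h (lift ord0 i))).
  move=> a; rewrite -Dsum => /eqP; rewrite subr_eq0 => /eqP.
  move/(wronskian_kernel h00) => [k Hk] i.
  (* The combination of the remaining polynomials equals k h_0, so it extends to a linear relation
     with coefficient -k at h_0. *)
  have := ind_h (fun i => if unlift ord0 i is Some j then a j else - k).
  rewrite big_ord_recl unlift_none => H.
  have -> : a i = if unlift ord0 (lift ord0 i) is Some j then a j else - k.
    by rewrite liftK.
  apply: H; under eq_bigr do rewrite liftK; by rewrite Hk scaleNr addNr.
(* Besides the zeros of [B], the point c has to avoid those of h_0; this settles the last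
   coefficient below. *)
exists (B * h0) => [|c]; first by rewrite mulf_neq0.
rewrite hornerM mulf_eq0 negb_or => /andP[Bc h0c] a dvd_a.
set p := \sum_i _ in dvd_a.
have a_lift i : a (lift ord0 i) = 0.
  apply: (HB _ Bc (fun i => a (lift ord0 i))); rewrite -Dsum.
  have -> : D (\sum_i a (lift ord0 i) *: h (lift ord0 i)) = D p.
    rewrite /p big_ord_recl DP.
    by rewrite -/h0 Dh0 scaler0 add0r.
  (* Differentiation lowers the order of vanishing at c by at most one, so the Wronskian of [p] with
     [h0] still vanishes to order r. *)
  case/dvdpP: dvd_a => q ->; rewrite /D derivM deriv_exp derivXsubC mul1r /=.
  apply: dvdp_sub; last by rewrite exprS mulrA -mulrA mulrCA dvdp_mulr.
  rewrite mulrDl exprS mulrA -[_ * h0]mulrA mulrCA; apply: dvdp_add.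
    by rewrite dvdp_mulr.
  by rewrite mulrnAr mulrnAl -mulrA mulrCA -mulrnAr dvdp_mulr.
have ep : p = a ord0 *: h0.
  by rewrite /p big_ord_recl big1 ?addr0 // => i _; rewrite a_lift scale0r.
have a0 : a ord0 = 0.
  apply/eqP; apply: contraT => a0.
  have : 'X - c%:P %| p by apply: dvdp_trans dvd_a; rewrite exprS dvdp_mulr.
  by rewrite ep dvdpZr // dvdp_XsubCl rootE (negPf h0c).
by move=> i; case: (unliftP ord0 i) => [j ->|->].
Qed.

End Wronskian.

(** * Linear substitutions and decomposition by powers of x_3 *)

Section Substitution.
Variable K : fieldType.
Notation S := {mpoly K[3]}.

Lemma mpoly_rmorph_eq n (R : comNzRingType) (u v : {rmorphism {mpoly K[n]} -> R}) :
  (forall c, u c%:MP = v c%:MP) -> (forall i, u 'X_i = v 'X_i) -> u =1 v.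
Proof.
move=> HC HX; elim/mpolyind => [|c m p _ _ IH]; first by rewrite !rmorph0.
rewrite -mul_mpolyC !rmorphD !rmorphM HC IH; congr (_ * _ + _).
rewrite mpolyXE_id !rmorph_prod; apply: eq_bigr => i _.
by rewrite !rmorphXn HX.
Qed.

Definition sub3 (x y z : S) : S -> S := comp_mpoly [tuple x; y; z].

HB.instance Definition _ x y z := GRing.RMorphism.copy (sub3 x y z)
  (comp_mpoly [tuple x; y; z]).
HB.instance Definition _ x y z := GRing.Linear.copy (sub3 x y z)
  (comp_mpoly [tuple x; y; z]).

Lemma sub3X x y z : [/\ sub3 x y z 'X_i0 = x, sub3 x y z 'X_i1 = y & sub3 x y z 'X_i2 = z].
Proof. by split; rewrite /sub3 comp_mpolyXU. Qed.

Lemma sub3C x y z c : sub3 x y z c%:MP = c%:MP.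
Proof. exact: comp_mpolyC. Qed.

Lemma sub3_homog x y z d p : x \is 1.-homog -> y \is 1.-homog -> z \is 1.-homog ->
  p \is d.-homog -> sub3 x y z p \is d.-homog.
Proof.
move=> hx hy hz /dhomogP hp; rewrite /sub3 comp_mpolyEX.
rewrite big_seq rpred_sum // => m /hp <-; rewrite rpredZ // comp_mpolyX.
rewrite /= mdegE; elim/big_rec2: _ => [|i n q _ Hq]; first exact: dhomog1.
apply: dhomogM => //.
have hi : tnth [tuple x; y; z] i \is 1.-homog.
  by move: i {Hq}; apply: ord3P; rewrite (tnth_nth 0).
by have := dhomogMn (m i) hi; rewrite mul1n.
Qed.

Lemma slice_sub3 ds b d (F : 'I_3 -> S) g x y z :
  x \is 1.-homog -> y \is 1.-homog -> z \is 1.-homog ->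
  slice ds b d F g -> slice ds b d (fun i => sub3 x y z (F i)) (sub3 x y z g).
Proof.
move=> hx hy hz [h Hh ->]; exists (fun i => sub3 x y z (h i)) => [i|].
  case: (leqP (ds i) d) => [le|lt]; last first.
    by rewrite (hshift_eq0 (Hh i) lt) rmorph0; exact: hshift0.
  rewrite -(subnK le); apply: homog_hshift; apply: sub3_homog => //.
  exact: hshift_homog.
by rewrite rmorph_sum; apply: eq_bigr => i _; rewrite rmorphM.
Qed.

(* Dehomogenisation x_1 = 1, with x_3 as the outer variable. *)
Definition polyCC (c : K) : {poly {poly K}} := c%:P%:P.

HB.instance Definition _ := GRing.RMorphism.copy polyCC (polyC \o polyC).

Definition dehom (i : 'I_3) : {poly {poly K}} := nth 0 [:: 1; 'X%:P; 'X] i.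

Definition slices (p : S) : {poly {poly K}} := mmap polyCC dehom p.

HB.instance Definition _ := GRing.isZmodMorphism.Build S {poly {poly K}} slices
  (mmap_is_additive dehom polyCC).
HB.instance Definition _ := GRing.isMonoidMorphism.Build S {poly {poly K}} slices
  ((mmap_is_multiplicative dehom polyCC).2, (mmap_is_multiplicative dehom polyCC).1).

Lemma slicesZ c p : slices (c *: p) = c%:P *: slices p.
Proof. by rewrite /slices mmapZ -mul_polyC. Qed.

Lemma coef_slicesX m k j :
  (slices 'X_[m])`_k`_j = ((m i2 == k) && (m i1 == j))%:R.
Proof.
rewrite /slices mmapX /mmap1 !big_ord_recl big_ord0 /dehom /= expr1n mul1r mulr1.
rewrite -rmorphXn coefCM coefXn /=.
have -> : lift ord0 (lift ord0 ord0) = i2 by apply/val_inj.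
have -> : lift ord0 ord0 = i1 by apply/val_inj.
rewrite eq_sym; case: eqP => _; last by rewrite mulr0 coef0.
by rewrite mulr1 coefXn eq_sym.
Qed.

(** A monomial of known degree is determined by its exponents of x_3 and x_2, so setting x_1 = 1
    loses nothing on forms. *)
Lemma coef_slices d p m : p \is d.-homog -> mdeg m = d ->
  (slices p)`_(m i2)`_(m i1) = p@_m.
Proof.
move=> hp dm; rewrite {1}(mpolyE p) rmorph_sum /= !coef_sum.
transitivity ((\sum_(k <- msupp p) p@_k *: 'X_[k])@_m); last by rewrite -mpolyE.
rewrite raddf_sum /= big_seq [RHS]big_seq; apply: eq_bigr => k sk.
have dk : mdeg k = d by move/dhomogP: hp; exact.
rewrite slicesZ coefZ coefCM coef_slicesX mcoeffZ mcoeffX; congr (_ * (nat_of_bool _)%:R).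
apply/idP/idP => [/andP[/eqP e2 /eqP e1]|/eqP ->]; last by rewrite !eqxx.
by apply/eqP; apply: (key_inj dk dm); rewrite /key e2 e1.
Qed.

Lemma coef_slices_eq0 (p : S) k j :
  (forall m : 'X_{1..3}, m i2 = k -> m i1 = j -> p@_m = 0) -> (slices p)`_k`_j = 0.
Proof.
move=> H; rewrite (mpolyE p) rmorph_sum /= !coef_sum big1 // => m _.
rewrite slicesZ coefZ coefCM coef_slicesX.
case: andP => [[/eqP /H e2 /eqP /e2 ->]|_]; by rewrite ?mul0r ?mulr0.
Qed.

Definition shear c : S -> S := sub3 'X_i0 ('X_i1 + c *: 'X_i0) 'X_i2.

HB.instance Definition _ c := GRing.LRMorphism.copy (shear c)
  (sub3 'X_i0 ('X_i1 + c *: 'X_i0) 'X_i2).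

Lemma homogU i : ('X_i : S) \is 1.-homog.
Proof. by rewrite dhomogX /= mdeg1. Qed.

Lemma shear_homog c d p : p \is d.-homog -> shear c p \is d.-homog.
Proof.
by apply: sub3_homog; rewrite ?rpredD ?rpredZ ?homogU.
Qed.

(** After x_1 = 1 the shear is the translation X -> X + c on each coefficient of a power of x_3.
    Both sides come from ring morphisms, which are compared on the variables. *)
Lemma slices_shear c p k : (slices (shear c p))`_k = (slices p)`_k \Po ('X + c%:P).
Proof.
pose v : {rmorphism {poly K} -> {poly K}} := comp_poly ('X + c%:P).
suff -> : slices (shear c p) = map_poly v (slices p) by rewrite coef_map.
pose f : {rmorphism S -> {poly {poly K}}} := slices \o shear c.
pose g : {rmorphism S -> {poly {poly K}}} := map_poly v \o slices.
apply: (mpoly_rmorph_eq (u := f) (v := g)) => [a|i]; rewrite /f /g /=.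
  by rewrite /shear sub3C /slices !mmapC /= !map_polyC /= /v comp_polyC.
have [X0 X1 X2] := sub3X 'X_i0 ('X_i1 + c *: 'X_i0) 'X_i2.
have U j : slices 'X_j = dehom j by rewrite /slices mmapX mmap1U.
move: i; apply: ord3P; rewrite /shear ?X0 ?X1 ?X2 !U /=.
- by rewrite rmorph1.
- rewrite rmorphD /= slicesZ !U /= map_polyC /= comp_polyX polyCD.
  by rewrite -mul_polyC mulr1.
- by rewrite map_polyX.
Qed.

End Substitution.

(** * Ranks after a generic shear *)

Section Shear.
Variables (K : fieldType) (charK : [pchar K] =i pred0) (ds : 'I_3 -> nat).
Notation S := {mpoly K[3]}.

Lemma comp_polyXaddCK (c : K) (p : {poly K}) :
  (p \Po ('X + c%:P)) \Po ('X - c%:P) = p.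
Proof. by rewrite -comp_polyA comp_polyD comp_polyX comp_polyC subrK comp_polyXr. Qed.

(** [A] consists of leading monomials with x_3-exponent below k, [B] of some with exponent k. If a
    combination of the sheared elements vanishes at all tested keys, its slices below k are zero;
    undoing the shear kills the coefficients on [A]. The k-th slice of the rest then vanishes to
    order j at c, which for generic c kills the coefficients on [B], as [B] has at most j
    members. *)
Lemma ind_shear b d (F : 'I_3 -> S) (A B : seq 'X_{1..3}) k j :
  uniq A -> uniq B -> homs ds F ->
  (forall m, m \in A -> lm (slice ds b d F) d m /\ (key d m < k * d.+1)%N) ->
  (forall m, m \in B -> lm (slice ds b d F) d m /\
     (k * d.+1 <= key d m < k.+1 * d.+1)%N) ->
  (size B <= j)%N ->
  exists c, ind_ge (slice ds b d (fun i => shear c (F i)))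
    (fun m => key d m < k * d.+1 + j)%N (size A + size B).
Proof.
move=> uA uB hF HA HB le_j; set V := slice ds b d F.
have [gA HgA] := leads_family (fun m mA => proj1 (HA m mA)).
have [gB HgB] := leads_family (fun m mB => proj1 (HB m mB)).
have homV g : V g -> g \is d.-homog by exact: slice_homog.
have linV : lin V by exact: slice_lin.
have dm_i m : mdeg m = d -> (m i1 <= d)%N by rewrite mdeg3; lia.
have key_k m : mdeg m = d -> (key d m < k * d.+1)%N = (m i2 < k)%N.
  by move/dm_i; rewrite /key => le; apply/idP/idP; nia.
have key_k1 m : mdeg m = d -> (key d m < k.+1 * d.+1)%N = (m i2 <= k)%N.
  by move/dm_i; rewrite /key => le; apply/idP/idP; nia.
have gB0 i m : mdeg m = d -> (key d m < k * d.+1)%N -> (gB i)@_m = 0.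
  move=> dm lt; have [_ [_ _]] := HgB i; apply => //.
  have := HB _ (mem_nth 0%MM (ltn_ord i)) => -[_ /andP[le _]].
  exact: leq_trans lt le.
pose h i := (slices (gB i))`_k.
have sum_slices n (a : 'I_n -> K) (g : 'I_n -> S) l :
    (slices (\sum_i a i *: g i))`_l = \sum_i a i *: (slices (g i))`_l.
  rewrite rmorph_sum coef_sum; apply: eq_bigr => i _ /=.
  by rewrite slicesZ coefZ mul_polyC.
(* The slices [h] are independent: the elements for [B] have no monomial of x_3-exponent below k, so
   a combination with zero k-th slice vanishes at all keys below (k+1)(d+1), and [leads_ind]
   applies. *)
have [a Ea i|W W0 HW] := generic_vanishing_order charK (h := h).
  apply: (leads_ind (d := d) (N := (k.+1 * d.+1)%N) (nth_inj uB)
    (fun i => proj2 (HgB i))) => [m dm|]; last first.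
    by have := HB _ (mem_nth 0%MM (ltn_ord i)) => -[_ /andP[]].
  rewrite key_k1 // leq_eqVlt => /orP[/eqP e2|]; last first.
    rewrite -key_k // => lt; rewrite mcoeff_sumZ big1 // => j' _.
    by rewrite gB0 ?mulr0.
  rewrite -(coef_slices (d := d) _ dm); last first.
    by apply: homV; apply: (lin_sum _ linV) => j'; case: (HgB j').
  by rewrite e2 sum_slices Ea coef0.
have [c Wc] := infinite_nonroot charK W0; exists c.
pose g (i : 'I_(size A + size B)) :=
  match split i with inl x => gA x | inr y => gB y end.
exists (fun i => shear c (g i)) => [i|a Ha].
  apply: slice_sub3; rewrite ?rpredD ?rpredZ ?homogU // /g.
  by case: split => x; [case: (HgA x)|case: (HgB x)].
pose aA x := a (lshift _ x); pose aB y := a (rshift _ y).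
pose GA := \sum_x aA x *: gA x; pose GB := \sum_y aB y *: gB y.
have EG : \sum_i a i *: shear c (g i) = shear c (GA + GB).
  rewrite rmorphD !rmorph_sum big_split_ord /=; congr (_ + _).
    apply: eq_bigr => x _; rewrite linearZ /g.
    by rewrite -/(unsplit (inl x)) unsplitK.
  apply: eq_bigr => x _; rewrite linearZ /g.
  by rewrite -/(unsplit (inr x)) unsplitK.
have homG : GA + GB \is d.-homog.
  apply: rpredD; apply: homV; apply: (lin_sum _ linV) => i.
    by case: (HgA i).
  by case: (HgB i).
have GB0 m : mdeg m = d -> (key d m < k * d.+1)%N -> GB@_m = 0.
  by move=> dm lt; rewrite mcoeff_sumZ big1 // => i _; rewrite gB0 ?mulr0.
have low l : (l < k)%N -> (slices (GA + GB))`_l = 0.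
  move=> lt_l.
  have : (slices (shear c (GA + GB)))`_l = 0.
    apply/polyP => i; rewrite coef0; apply: coef_slices_eq0 => m m2 m1.
    have [/eqP dm|dm] := boolP (mdeg m == d); last first.
      by rewrite (dhomog_nemf_coeff _ dm) // shear_homog.
    rewrite -EG; apply: Ha; apply: ltn_addr; rewrite key_k // m2 //.
  rewrite slices_shear => E.
  by rewrite -(comp_polyXaddCK c (slices _)`_l) E comp_poly0.
have aA0 x : aA x = 0.
  apply: (leads_ind (d := d) (N := (k * d.+1)%N) (nth_inj uA)
    (fun i => proj2 (HgA i))) => [m dm lt|]; last first.
    by have := HA _ (mem_nth 0%MM (ltn_ord x)) => -[].
  have : (GA + GB)@_m = 0 by rewrite -(coef_slices homG dm) low ?coef0 -?key_k.
  by rewrite mcoeffD GB0 // addr0.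
have GA0 : GA = 0 by rewrite /GA big1 // => x _; rewrite aA0 scale0r.
have aB0 y : aB y = 0.
  apply: (HW _ Wc); rewrite /h -sum_slices -/GB.
  apply: (dvdp_trans (dvdp_exp2l _ le_j)).
  (* The tested keys with x_3-exponent k are those with x_2-exponent below j, that is, the
     coefficients of 1, ..., X^(j-1). *)
  have : 'X^j %| (slices (shear c GB))`_k.
    rewrite -(poly_take_drop j (slices _)`_k); apply: dvdp_add; last exact: dvdp_mull.
    suff -> : take_poly j (slices (shear c GB))`_k = 0 by exact: dvdp0.
    apply/polyP => i; rewrite coef_take_poly coef0; case: ifP => // lt_i.
    apply: coef_slices_eq0 => m m2 m1.
    have [/eqP dm|dm] := boolP (mdeg m == d); last first.
      rewrite (dhomog_nemf_coeff _ dm) // shear_homog //.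
      by rewrite -[GB]add0r -GA0.
    have := EG; rewrite GA0 add0r => <-; apply: Ha.
    by rewrite /key m2 m1 ltn_add2l.
  (* Undoing the translation turns X^j into (X - c)^j. *)
  rewrite slices_shear => /dvdpP[q Eq]; apply/dvdpP; exists (q \Po ('X - c%:P)).
  rewrite -(comp_polyXaddCK c (slices _)`_k) Eq comp_polyM.
  by rewrite rmorphXn /= comp_polyX.
move=> i; rewrite -(splitK i); case: (split i) => x; [exact: aA0|exact: aB0].
Qed.

End Shear.

(** * The strong Lefschetz property of monomial complete intersections *)

Section Lefschetz.
Variables (K : fieldType) (charK : [pchar K] =i pred0) (ds : 'I_3 -> nat).
Notation S := {mpoly K[3]}.

Implicit Types p q : {mpoly K[3]}.

Definition in_pows (m : 'X_{1..3}) : bool := [exists i, ds i <= m i]%N.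

(** The monomial ideal generated by the x_i^d_i, with membership read off the support. *)
Definition pow_ideal (p : S) : Prop := forall m, ~~ in_pows m -> p@_m = 0.

Lemma pow_ideal0 : pow_ideal 0.
Proof. by move=> m _; rewrite mcoeff0. Qed.

Lemma pow_idealP c p q : pow_ideal p -> pow_ideal q -> pow_ideal (c *: p + q).
Proof. by move=> Hp Hq m Hm; rewrite mcoeffD mcoeffZ Hp ?Hq // mulr0 addr0. Qed.

Lemma pow_idealZ c p : c != 0 -> pow_ideal (c *: p) -> pow_ideal p.
Proof.
by move=> c0 Hp m /Hp/eqP; rewrite mcoeffZ mulf_eq0 (negPf c0) => /eqP.
Qed.

Lemma in_powsW m k : (k <= m)%MM -> in_pows k -> in_pows m.
Proof.
move=> /mnm_lepP le /existsP[i Hi]; apply/existsP; exists i.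
exact: leq_trans Hi (le i).
Qed.

Lemma pow_idealM p q : pow_ideal p -> pow_ideal (q * p).
Proof.
move=> Hp; rewrite (mpolyE q) mulr_suml.
elim/big_rec: _ => [|m x _ Hx]; first exact: pow_ideal0.
rewrite -scalerAl; apply: pow_idealP => // k Hk; rewrite mulrC coef_mulX.
case: ifP => // le; apply: Hp; apply: contra Hk; apply: in_powsW.
exact: lem_subr.
Qed.

Definition lsum : S := \sum_i 'X_i.

(* Together with multiplication by x_1 + x_2 + x_3 this generates an sl_2; on
   powers of the variable x_i it is x_i^n |-> n (d_i - n) x_i^(n-1). *)
Definition lowering (p : S) : S :=
  \sum_i ((ds i).-1%:R *: p^`M(i) - 'X_i * p^`M(i)^`M(i)).

Lemma coefXderiv i (p : S) m : ('X_i * p^`M(i))@_m = (m i)%:R * p@_m.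
Proof.
rewrite mulrC coef_mulX mcoeff_mderiv; case: ifP => [le|nle].
  have mi_gt0 : (0 < m i)%N by move/mnm_lepP/(_ i): le; rewrite mnm1E eqxx.
  by rewrite submK // mnmBE mnm1E eqxx subn1 prednK // mulr_natl.
suff -> : m i = 0%N by rewrite mul0r.
apply/eqP; rewrite -leqn0 leqNgt; apply: contraFN nle => mi_gt0.
by apply/mnm_lepP => j; rewrite mnm1E; case: eqP => [<-|].
Qed.

Lemma coef_lowering p m : (lowering p)@_m =
  \sum_i ((ds i).-1%:R - (m i)%:R) * ((m i).+1%:R * p@_(m + U_(i))).
Proof.
rewrite raddf_sum; apply: eq_bigr => i _ /=.
rewrite mcoeffB mcoeffZ coefXderiv !mcoeff_mderiv mulrBl.
by rewrite -[_ *+ (m i).+1]mulr_natl.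
Qed.

(** If m is outside the ideal but m x_i is inside, then m has x_i-exponent d_i - 1, and the factor
    d_i - 1 - m_i in [coef_lowering] vanishes. So the operator descends to the quotient. *)
Lemma lowering_pow_ideal p : pow_ideal p -> pow_ideal (lowering p).
Proof.
move=> Hp m Hm; rewrite coef_lowering big1 // => i _.
have [|/Hp ->] := boolP (in_pows (m + U_(i))%MM); last by rewrite !mulr0.
case/existsP => j; rewrite mnmDE mnm1E => le.
have := Hm; rewrite negb_exists => /forallP/(_ j); rewrite -ltnNge => lt.
case: eqP le => [->|_] le; last by move: le lt; rewrite addn0; lia.
suff -> : (ds j).-1 = m j by rewrite subrr mul0r.
by lia.
Qed.

Lemma lowering_hshift p n : p \is n.-homog -> hshift n 1 (lowering p).
Proof.
move=> hp m; rewrite coef_lowering; apply: contraNeq => ne; rewrite big1 // => i _.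
by rewrite (dhomog_nemf_coeff hp) ?mulr0 //= mdegD mdeg1.
Qed.

Lemma lowering_homog0 p : p \is 0.-homog -> lowering p = 0.
Proof. by move/lowering_hshift => H; apply: (hshift_eq0 H). Qed.

Lemma lowering_homog p n : p \is n.+1.-homog -> lowering p \is n.-homog.
Proof. by move/lowering_hshift => H; have := hshift_homog H; rewrite subn1; apply. Qed.

Lemma loweringP c p q : lowering (c *: p + q) = c *: lowering p + lowering q.
Proof.
rewrite /lowering scaler_sumr -big_split; apply: eq_bigr => i _ /=.
rewrite !(mderivD, mderivZ) mulrDr scalerBr -!scalerAr scalerDr !scalerA.
by rewrite [c * _]mulrC opprD addrACA.
Qed.

(** The top degree of the quotient by the x_i^d_i. *)
Definition socle_deg := (\sum_i (ds i).-1)%N.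

Lemma lsum_homog : lsum \is 1.-homog.
Proof. by apply: rpred_sum => i _; rewrite homogU. Qed.

Lemma lsumX_homog k p n : p \is n.-homog -> lsum ^+ k * p \is (n + k).-homog.
Proof.
move=> hp; rewrite addnC; apply: dhomogM => //.
by have := dhomogMn k lsum_homog; rewrite mul1n.
Qed.

Lemma deriv_lsum i : lsum^`M(i) = 1.
Proof.
rewrite /lsum raddf_sum (bigD1 i) //= big1 => [|j ne_ji].
  rewrite addr0 mderivX mnm1E eqxx scale1r.
  suff -> : (U_(i) - U_(i) = 0 :> 'X_{1..3})%MM by rewrite mpolyX0.
  by apply/mnmP => j; rewrite mnmBE subnn mnm0E.
by rewrite mderivX mnm1E (negPf ne_ji) scale0r.
Qed.

Lemma euler p n : p \is n.-homog -> \sum_i 'X_i * p^`M(i) = n%:R *: p.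
Proof.
move=> hp; apply/mpolyP => m; rewrite raddf_sum mcoeffZ /=.
under eq_bigr do rewrite coefXderiv.
rewrite -mulr_suml -natr_sum -mdegE.
have [/eqP -> //|dm] := boolP (mdeg m == n).
by rewrite (dhomog_nemf_coeff hp dm) !mulr0.
Qed.

(** The sl_2 commutation relation: degree n has weight s - 2n, with s the socle degree. It follows
    from the Leibniz rule and Euler's identity. *)
Lemma lowering_lsum p n : p \is n.-homog ->
  lowering (lsum * p) = lsum * lowering p + (socle_deg%:R - (n * 2)%:R) *: p.
Proof.
move=> hp; have E i : (ds i).-1%:R *: (lsum * p)^`M(i) - 'X_i * (lsum * p)^`M(i)^`M(i) =
   lsum * ((ds i).-1%:R *: p^`M(i) - 'X_i * p^`M(i)^`M(i)) +
   ((ds i).-1%:R *: p - 'X_i * p^`M(i) *+ 2).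
  have d1 : (1 : S)^`M(i) = 0 by rewrite -mpolyC1 mderivC.
  rewrite !(mderivM, mderivD, deriv_lsum, d1) -!mul_mpolyC.
  by ring.
rewrite /lowering (eq_bigr _ (fun i _ => E i)) big_split /= -mulr_sumr; congr (_ + _).
rewrite sumrB -scaler_suml -natr_sum -/socle_deg sumrMnl (euler hp) scalerBl.
by rewrite natrM mulr_natr scalerMnl.
Qed.

(** Iterating the commutation relation adds up the weights s - 2n - 2j for j < k. *)
Lemma lowering_lsumX k p n : p \is n.-homog -> lowering (lsum ^+ k * p) =
  lsum ^+ k * lowering p + (k%:R * (socle_deg%:R - (n * 2)%:R - k%:R + 1)) *: (lsum ^+ k.-1 * p).
Proof.
move=> hp; elim: k => [|k IH]; first by rewrite !expr0 !mul1r mul0r scale0r addr0.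
rewrite exprS -mulrA (lowering_lsum (lsumX_homog k hp)) IH mulrDr mulrA.
rewrite -addrA; congr (_ + _); rewrite -scalerAr /= mulrA.
case: k {IH} => [|k] /=.
  by rewrite mul0r scale0r add0r !expr0 mul1r mul1r subrK addn0.
rewrite -exprS -scalerDl; congr (_ *: _).
rewrite -[k.+2]addn1 -[k.+1]addn1 !natrM !natrD; ring.
Qed.

Lemma natr_neq0 n : (0 < n)%N -> n%:R != 0 :> K.
Proof. by rewrite (proj1 (pcharf0P K) charK) lt0n. Qed.

(** Write L for [lsum] and F for [lowering]. Applying F to the hypothesis gives one of the same
    shape for F p, one degree lower, with l increased by the nonnegative weight of F p. By induction
    F p is in the ideal, hence so is l p. *)
Lemma no_negative_eigenvalue n l p : p \is n.-homog -> (n * 2 <= socle_deg)%N -> (0 < l)%N ->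
  pow_ideal (lsum * lowering p + l%:R *: p) -> pow_ideal p.
Proof.
elim: n l p => [|n IH] l p hp le_s l_gt0 H.
  by move: H; rewrite lowering_homog0 // mulr0 add0r; apply/pow_idealZ/natr_neq0.
have hq := lowering_homog hp; have Hq : pow_ideal (lowering p).
  apply: (IH (socle_deg - n * 2 + l)%N) => //; try lia.
  have := lowering_pow_ideal H; rewrite addrC loweringP addrC (lowering_lsum hq) -addrA -scalerDl.
  by rewrite natrD natrB //; lia.
have : pow_ideal (l%:R *: p).
  rewrite -[_ *: p](addKr (lsum * lowering p)) addrC -scaleN1r addrC.
  by apply: pow_idealP => //; exact: pow_idealM.
exact/pow_idealZ/natr_neq0.
Qed.

(* Applying the lowering operator F to L^(k+1) p yields L^k (L F p + l p) with
   l > 0, and L F has no negative eigenvalue. *)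
Lemma lsum_injective k n p : p \is n.-homog -> (n * 2 + k <= socle_deg)%N ->
  pow_ideal (lsum ^+ k * p) -> pow_ideal p.
Proof.
elim: k n p => [|k IH] n p hp le_s H; first by rewrite mul1r in H.
have hq : lsum * lowering p + ((k.+1 * (socle_deg - n * 2 - k))%N)%:R *: p \is n.-homog.
  rewrite rpredD ?rpredZ //; case: n hp {le_s} => [|n] hp.
    by rewrite lowering_homog0 // mulr0 dhomog0.
  by have := lsumX_homog 1 (lowering_homog hp); rewrite expr1 addn1.
apply: (no_negative_eigenvalue hp _ _ (IH n _ hq _ _)); try nia.
have := lowering_pow_ideal H; rewrite (lowering_lsumX _ hp) /= exprSr -mulrA scalerAr -mulrDr.
suff -> : k.+1%:R * (socle_deg%:R - (n * 2)%:R - k.+1%:R + 1) =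
  ((k.+1 * (socle_deg - n * 2 - k))%N)%:R :> K by [].
rewrite [RHS]natrM natrB; last by lia.
rewrite natrB; last by lia.
by rewrite -[k.+1]addn1 natrD; ring.
Qed.

End Lefschetz.

(** * Surjectivity by duality, and the special family of powers *)

Section Special.
Variables (K : fieldType) (charK : [pchar K] =i pred0) (ds : 'I_3 -> nat).
Hypothesis ds_gt0 : forall i, (0 < ds i)%N.
Notation S := {mpoly K[3]}.
Notation in_pows := (in_pows ds).
Notation pow_ideal := (@pow_ideal K ds).
Notation lsum := (lsum K).
Notation socle_deg := (socle_deg ds).
Implicit Types p q g : S.

Lemma not_in_pows_lt m i : ~~ in_pows m -> (m i < ds i)%N.
Proof. by rewrite negb_exists => /forallP/(_ i); rewrite -ltnNge. Qed.

Lemma in_pows_large m : (socle_deg < mdeg m)%N -> in_pows m.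
Proof.
move=> lt; apply: contraLR lt => nmi; rewrite -leqNgt mdegE.
apply: leq_sum => i _; have := not_in_pows_lt i nmi; have := ds_gt0 i; lia.
Qed.

Lemma sum3 (f : 'I_3 -> nat) : (\sum_i f i = f i0 + f i1 + f i2)%N.
Proof.
rewrite !big_ord_recl big_ord0 addn0 addnA.
by congr (f _ + f _ + f _)%N; apply/val_inj.
Qed.

(** The complement m_i -> d_i - 1 - m_i exchanges standard monomials of degrees d and e. *)
Lemma count_symm d e : (d + e = socle_deg)%N ->
  (count (predC in_pows) (mons d) <= count (predC in_pows) (mons e))%N.
Proof.
move=> de; pose inv (m : 'X_{1..3}) := [multinom ((ds i).-1 - m i)%N | i < 3].
rewrite -!size_filter -(size_map inv).
have nmiP m : m \in [seq m <- mons d | predC in_pows m] ->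
    (forall i, (m i <= (ds i).-1)%N) /\ mdeg m = d.
  rewrite mem_filter mem_mons => /andP[nmi /eqP dm]; split=> // i.
  by have := not_in_pows_lt i nmi; have := ds_gt0 i; lia.
apply: uniq_leq_size => [|m /mapP[k /nmiP[le dk] ->]].
  rewrite map_inj_in_uniq; first exact: (filter_uniq _ (mons_uniq d)).
  move=> k l /nmiP[lek _] /nmiP[lel _] E.
  apply/mnmP => i; move/mnmP/(_ i): E; rewrite !mnmE.
  by have := lek i; have := lel i; lia.
rewrite mem_filter mem_mons; apply/andP; split.
  rewrite /= negb_exists; apply/forallP => i; rewrite mnmE -ltnNge.
  by have := ds_gt0 i; lia.
have := le i0; have := le i1; have := le i2; move: de dk.
rewrite /socle_deg sum3 !mdeg3 !mnmE; lia.
Qed.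

(** Beyond the socle degree everything is in the ideal. Otherwise let e be the degree dual to n + k,
    so e <= n. By [lsum_injective] the power of [lsum] from degree e to n + k is injective on the
    quotient, and by [count_symm] the dimensions force it to be onto; it factors through the k-th
    power. *)
Lemma lsum_surjective k n p : (socle_deg <= n * 2 + k)%N -> p \is (n + k).-homog ->
  exists2 q, q \is n.-homog & pow_ideal (p - lsum ^+ k * q).
Proof.
move=> le_s hp; have [lt|le] := ltnP socle_deg (n + k).
  exists 0; first exact: dhomog0.
  move=> m Hm; rewrite mulr0 subr0 (dhomog_nemf_coeff hp) //=.
  by apply: contra Hm => /eqP dm; apply: in_pows_large; rewrite dm.
set e := (socle_deg - (n + k))%N.
pose V g := exists2 q, q \is e.-homog & g = lsum ^+ (k + (n - e)) * q.
have linV : lin V.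
  split; first by exists 0; rewrite ?dhomog0 ?mulr0.
  move=> c g h [q hq ->] [q' hq' ->]; exists (c *: q + q').
    by rewrite rpredD ?rpredZ.
  by rewrite mulrDr scalerAr.
have homV g : V g -> g \is (n + k).-homog.
  move=> [q hq ->]; have := lsumX_homog (k + (n - e)) hq.
  by congr (_ \is _.-homog); rewrite /e; lia.
have indV : ind_ge V (predC in_pows) (count (predC in_pows) (mons (n + k))).
  have le_c : (count (predC in_pows) (mons (n + k)) <= count (predC in_pows) (mons e))%N.
    by apply: count_symm; rewrite /e; lia.
  apply: ind_mono le_c _; rewrite -size_filter.
  set t := [seq m <- mons e | _]; have ut : uniq t by exact: (filter_uniq _ (mons_uniq e)).
  have ht i : (i < size t)%N -> mdeg (nth 0%MM t i) = e /\ ~~ in_pows (nth 0%MM t i).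
    by move/(mem_nth 0%MM); rewrite mem_filter mem_mons => /andP[? /eqP].
  exists (fun i => lsum ^+ (k + (n - e)) * 'X_[nth 0%MM t i]) => [i|a Ha i].
    exists 'X_[nth 0%MM t i] => //; rewrite dhomogX /=.
    by case: (ht i (ltn_ord i)) => ->.
  have : pow_ideal (\sum_i a i *: 'X_[nth 0%MM t i]).
    apply: (lsum_injective charK (k := (k + (n - e))%N) (n := e)).
    - apply: rpred_sum => j _; rewrite rpredZ // dhomogX /=.
      by case: (ht j (ltn_ord j)) => ->.
    - by rewrite /e; lia.
    - move=> m Hm; rewrite mulr_sumr -[RHS](Ha m Hm); congr (_@_m).
      by apply: eq_bigr => j _; rewrite scalerAr.
  move/(_ _ (proj2 (ht i (ltn_ord i)))).
  rewrite mcoeff_sumZ (bigD1 i) //= mcoeffX eqxx mulr1 big1 ?addr0 // => j ne_ji.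
  rewrite mcoeffX; case: eqP => [/eqP|_]; last by rewrite mulr0.
  by rewrite nth_uniq // => /eqP/val_inj e_ji; rewrite e_ji eqxx in ne_ji.
have [g [q hq ->] Hq] := ind_surj linV homV indV p.
exists (lsum ^+ (n - e) * q).
  have := lsumX_homog (n - e) hq; congr (_ \is _.-homog); rewrite /e; lia.
rewrite mulrA -exprD => m Hm; have [/eqP dm|dm] := boolP (mdeg m == n + k)%N.
  exact: Hq.
rewrite (dhomog_nemf_coeff _ dm) // rpredB //; apply: homV; by exists q.
Qed.

Definition var_pows (i : 'I_3) : S := 'X_[U_(i) *+ ds i].

Lemma var_pows_homog : homs ds var_pows.
Proof. by move=> i; rewrite dhomogX /= mdegMn mdeg1 mul1n. Qed.

Lemma U_le i (m : 'X_{1..3}) : (U_(i) *+ ds i <= m)%MM = (ds i <= m i)%N.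
Proof.
apply/mnm_lepP/idP => [/(_ i)|le j]; rewrite mulmnE mnm1E.
  by rewrite eqxx mul1n.
by case: eqP => [<-|_]; rewrite ?mul1n ?mul0n.
Qed.

Lemma slice_var_powsX (b : pred 'I_3) i (m : 'X_{1..3}) : b i -> (ds i <= m i)%N ->
  slice ds b (mdeg m) var_pows 'X_[m].
Proof.
move=> bi le; exists (fun j => if j == i then 'X_[m - U_(i) *+ ds i] else 0) => [j|].
  case: eqP => [->|_]; last exact: hshift0.
  move=> k; rewrite mcoeffX; case: (eqVneq _ k) => [<- _|_]; last by rewrite eqxx.
  rewrite -{2}(submK (m := U_(i) *+ ds i) (m' := m)) ?U_le // mdegD.
  by rewrite mdegMn mdeg1 mul1n.
rewrite (bigD1 i) //= eqxx big1 ?addr0 => [|j /andP[_ /negPf ->]]; last by rewrite mul0r.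
by rewrite /var_pows -mpolyXD submK // U_le.
Qed.

Lemma slice_var_powsP d g : slice ds predT d var_pows g <-> g \is d.-homog /\ pow_ideal g.
Proof.
split=> [Vg|[/dhomogP hg Ig]].
  split; first exact: slice_homog var_pows_homog Vg.
  case: Vg => h _ -> m Hm; rewrite raddf_sum big1 // => i _ /=.
  by rewrite coef_mulX U_le leqNgt (not_in_pows_lt i Hm).
have [V0 VP] := slice_lin ds predT d var_pows.
rewrite (mpolyE g) big_seq; elim/big_rec: _ => // m x sm Vx; apply: VP => //.
rewrite -(hg _ sm); have : in_pows m.
  by apply: contraLR sm => /Ig E; rewrite -mcoeff_eq0 E.
by case/existsP => i le; exact: slice_var_powsX le.
Qed.

(** This coordinate change turns multiplication by x_3 into multiplication by [lsum], so the
    Lefschetz results become statements about x_3. *)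
Definition shiftL : S -> S := sub3 'X_i0 'X_i1 lsum.
Definition unshiftL : S -> S := sub3 'X_i0 'X_i1 ('X_i2 - 'X_i0 - 'X_i1).
HB.instance Definition _ := GRing.LRMorphism.copy shiftL (sub3 'X_i0 'X_i1 lsum).
HB.instance Definition _ := GRing.LRMorphism.copy unshiftL
  (sub3 'X_i0 'X_i1 ('X_i2 - 'X_i0 - 'X_i1)).

Lemma lsumE : lsum = 'X_i0 + 'X_i1 + 'X_i2.
Proof.
rewrite /lsum !big_ord_recl big_ord0 addr0 addrA.
by congr ('X__ + 'X__ + 'X__); apply/val_inj.
Qed.

Lemma unshiftL_lin : ('X_i2 - 'X_i0 - 'X_i1 : S) \is 1.-homog.
Proof. by rewrite !rpredB ?homogU. Qed.

Lemma shiftLK : cancel shiftL unshiftL.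
Proof.
have [X0 X1 X2] := sub3X 'X_i0 'X_i1 lsum.
have [Y0 Y1 Y2] := sub3X 'X_i0 'X_i1 ('X_i2 - 'X_i0 - 'X_i1 : S).
pose u : {rmorphism S -> S} := unshiftL \o shiftL.
pose v : {rmorphism S -> S} := idfun.
apply: (mpoly_rmorph_eq (u := u) (v := v)) => [c|i]; rewrite /u /v /=.
  by rewrite /shiftL /unshiftL !sub3C.
move: i; apply: ord3P; rewrite /shiftL ?X0 ?X1 ?X2.
- by rewrite /unshiftL Y0.
- by rewrite /unshiftL Y1.
by rewrite lsumE !rmorphD /= /unshiftL Y0 Y1 Y2; ring.
Qed.

Lemma unshiftLK : cancel unshiftL shiftL.
Proof.
have [X0 X1 X2] := sub3X 'X_i0 'X_i1 lsum.
have [Y0 Y1 Y2] := sub3X 'X_i0 'X_i1 ('X_i2 - 'X_i0 - 'X_i1 : S).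
pose u : {rmorphism S -> S} := shiftL \o unshiftL.
pose v : {rmorphism S -> S} := idfun.
apply: (mpoly_rmorph_eq (u := u) (v := v)) => [c|i]; rewrite /u /v /=.
  by rewrite /shiftL /unshiftL !sub3C.
move: i; apply: ord3P; rewrite /unshiftL ?Y0 ?Y1 ?Y2.
- by rewrite /shiftL X0.
- by rewrite /shiftL X1.
by rewrite !rmorphB /= /shiftL X0 X1 X2 lsumE; ring.
Qed.

(** The family x_1^d_1, x_2^d_2, (x_3 - x_1 - x_2)^d_3, for which x_3 is a strong Lefschetz
    element. *)
Definition lef_pows (i : 'I_3) : S := unshiftL (var_pows i).

Lemma lef_pows_homog : homs ds lef_pows.
Proof.
by move=> i; apply: sub3_homog; rewrite ?homogU ?unshiftL_lin //; exact: var_pows_homog.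
Qed.

Lemma slice_ext (b : pred 'I_3) d (F G : 'I_3 -> S) g :
  F =1 G -> slice ds b d F g -> slice ds b d G g.
Proof. by move=> E [h Hh ->]; exists h => //; apply: eq_bigr => i _; rewrite E. Qed.

Lemma slice_lef_powsP d g :
  slice ds predT d lef_pows g <-> g \is d.-homog /\ pow_ideal (shiftL g).
Proof.
split=> [Vg|[hg Ig]].
  split; first exact: slice_homog lef_pows_homog Vg.
  have [] // : shiftL g \is d.-homog /\ pow_ideal (shiftL g).
  apply/slice_var_powsP; apply: (@slice_ext _ _ (fun i => shiftL (lef_pows i))) => [i|].
    by rewrite /lef_pows unshiftLK.
  by apply: slice_sub3; rewrite ?homogU ?lsum_homog.
rewrite -(shiftLK g); apply: slice_sub3; rewrite ?homogU ?unshiftL_lin //.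
by apply/slice_var_powsP; split=> //; apply: sub3_homog; rewrite ?homogU ?lsum_homog.
Qed.

End Special.

(** * Dimensions and multiplication by powers of x_3 for the special family *)

Section Hilbert.
Variables (K : fieldType) (charK : [pchar K] =i pred0) (ds : 'I_3 -> nat).
Hypothesis ds_gt0 : forall i, (0 < ds i)%N.
Notation S := {mpoly K[3]}.
Notation in_pows := (in_pows ds).
Notation pow_ideal := (@pow_ideal K ds).
Notation lsum := (lsum K).
Notation lef_pows := (@lef_pows K ds).
Notation var_pows := (@var_pows K ds).
Notation V := (slice ds predT).
Implicit Types (p q g : S) (m : 'X_{1..3}).

(** It exceeds every key in degree d, so [rho] at this bound is the full dimension of a space of
    forms of degree d. *)
Definition key_bound d := (d.+1 * d.+1)%N.

Lemma key_lt_bound d m : mdeg m = d -> (key d m < key_bound d)%N.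
Proof. by rewrite mdeg3 /key /key_bound => dm; nia. Qed.

Lemma key_ltM d k m : mdeg m = d -> (key d m < k * d.+1)%N = (m i2 < k)%N.
Proof. by rewrite mdeg3 /key => dm; apply/idP/idP; nia. Qed.

Lemma homog_eq0 d g : g \is d.-homog ->
  (forall m, (key d m < key_bound d)%N -> g@_m = 0) -> g = 0.
Proof.
move=> hg H; apply/mpolyP => m; rewrite mcoeff0.
have [/eqP dm|dm] := boolP (mdeg m == d); first by rewrite H // key_lt_bound.
by rewrite (dhomog_nemf_coeff hg dm).
Qed.

(** The coordinate change preserves dimension, and the graded pieces of the monomial ideal have the
    monomials in [in_pows] as basis. *)
Lemma rho_lef_pows d : rho (V d lef_pows) d (key_bound d) = count in_pows (mons d).
Proof.
have Vhom := slice_homog (@lef_pows_homog K ds).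
apply/eqP; rewrite eqn_leq -size_filter; apply/andP; split.
  have [g Vg indg] := ind_rho (V d lef_pows) d (key_bound d).
  have : ind_ge (V d var_pows) (fun m => key d m < key_bound d)%N
      (rho (V d lef_pows) d (key_bound d)).
    exists (fun i => shiftL (g i)) => [i|a Ha].
      apply/slice_var_powsP; have /slice_lef_powsP[hg Ig] := Vg i; split=> //.
      by apply: sub3_homog; rewrite ?homogU ?lsum_homog.
    have E : shiftL (\sum_i a i *: g i) = 0.
      apply: (homog_eq0 (d := d)).
        apply: sub3_homog; rewrite ?homogU ?lsum_homog //.
        by apply: Vhom; apply: (lin_sum _ (slice_lin _ _ _ _)) => i; exact: Vg.
      move=> m /Ha <-; rewrite rmorph_sum; congr (_@_m).
      by apply: eq_bigr => i _; rewrite /= linearZ.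
    apply: indg => m _; have := congr1 (@unshiftL K) E; rewrite shiftLK => ->.
    by rewrite rmorph0 mcoeff0.
  move/(ind_le (slice_lin _ _ _ _)); apply=> h /slice_var_powsP[hh Ih] H m _.
  have [mm|/Ih //] := boolP (in_pows m).
  have [/eqP dm|dm] := boolP (mdeg m == d); last by rewrite (dhomog_nemf_coeff hh dm).
  by apply: H; rewrite mem_filter mm mem_mons dm eqxx.
apply: rho_ge; [exact: slice_lin|exact: Vhom|].
set t := [seq m <- _ | _]; have ut : uniq t by exact: (filter_uniq _ (mons_uniq d)).
have ht i : (i < size t)%N -> in_pows (nth 0%MM t i) /\ mdeg (nth 0%MM t i) = d.
  by move/(mem_nth 0%MM); rewrite mem_filter mem_mons => /andP[? /eqP].
exists (fun i => unshiftL 'X_[nth 0%MM t i]) => [i|a Ha i].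
  have [mt dt] := ht _ (ltn_ord i).
  apply/slice_lef_powsP; rewrite unshiftLK; split.
    by apply: sub3_homog; rewrite ?homogU ?unshiftL_lin // dhomogX /= dt.
  by move=> m; rewrite mcoeffX; case: eqP => // <-; rewrite mt.
have : \sum_i a i *: unshiftL 'X_[nth 0%MM t i] = 0.
  apply: (homog_eq0 (d := d)) => //; apply: rpred_sum => j _; rewrite rpredZ //.
  have [mt dt] := ht _ (ltn_ord j).
  by apply: sub3_homog; rewrite ?homogU ?unshiftL_lin // dhomogX /= dt.
move/(congr1 (@shiftL K)); rewrite rmorph_sum rmorph0.
move/(congr1 (mcoeff (nth 0%MM t i))); rewrite mcoeff0 raddf_sum (bigD1 i) //=.
rewrite linearZ /= unshiftLK mcoeffZ mcoeffX eqxx mulr1 big1 ?addr0 // => j ne_ji.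
rewrite linearZ /= unshiftLK mcoeffZ mcoeffX; case: eqP => [/eqP|_]; last by rewrite mulr0.
by rewrite nth_uniq // => /eqP/val_inj e_ji; rewrite e_ji eqxx in ne_ji.
Qed.

Lemma mulX_ex g k : (forall m, g@_m != 0 -> (k <= m)%MM) -> exists q, g = q * 'X_[k].
Proof.
move=> H; exists (\sum_(m <- msupp g) g@_m *: 'X_[m - k]).
rewrite mulr_suml {1}(mpolyE g) big_seq [RHS]big_seq; apply: eq_bigr => m.
by rewrite mcoeff_msupp => /H le; rewrite -scalerAl -mpolyXD submK.
Qed.

Lemma mulX_homog d k q : q * 'X_[k] \is (d + mdeg k).-homog -> q \is d.-homog.
Proof.
move=> hg; apply/dhomogP => m; rewrite mcoeff_msupp => qm.
move/dhomogP: hg => /(_ (k + m)%MM); rewrite mcoeff_msupp mcoeffMX => /(_ qm) /=.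
by rewrite mdegD; lia.
Qed.

Definition Z_ k : 'X_{1..3} := (U_(i2) *+ k)%MM.

Lemma mdeg_Z k : mdeg (Z_ k) = k.
Proof. by rewrite /Z_ mdegMn mdeg1 mul1n. Qed.

Lemma Z_le k m : (Z_ k <= m)%MM = (k <= m i2)%N.
Proof.
apply/mnm_lepP/idP => [/(_ i2)|le j]; rewrite mulmnE mnm1E.
  by rewrite eqxx mul1n.
by case: eqP => [<-|_]; rewrite ?mul1n ?mul0n.
Qed.

(** In revlex, a form whose leading monomial is divisible by x_3^k is itself divisible by x_3^k.
    Dividing it, injectivity puts the quotient in the ideal, so every leading monomial of
    x_3-exponent at least k is x_3^k times one of degree d. *)
Lemma rho_mulX_le b d k F : homs ds F ->
  (forall q, q \is d.-homog -> slice ds b (d + k) F (q * 'X_[Z_ k]) -> slice ds b d F q) ->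
  (rho (slice ds b (d + k) F) (d + k) (key_bound (d + k)) <=
   rho (slice ds b (d + k) F) (d + k) (k * (d + k).+1) + rho (slice ds b d F) d (key_bound d))%N.
Proof.
move=> hF inj.
rewrite /rho -(size_map (fun m => (Z_ k + m)%MM) (lms _ d _)) -size_cat.
apply: uniq_leq_size => [|u]; first exact: lms_uniq.
rewrite mem_cat !mem_lms => /andP[lu _]; rewrite lu /=.
case: (leqP (k * (d + k).+1) (key (d + k) u)) => //= le.
case/lmP: (lu) => g Vg lg; case: (lg) => du gu Hu.
have le_k : (k <= u i2)%N by rewrite leqNgt -(key_ltM _ du) -leqNgt.
have [m gm|q eg] := mulX_ex (g := g) (k := Z_ k).
  rewrite Z_le leqNgt; apply: contra gm => lt.
  have [/eqP dm|dm] := boolP (mdeg m == d + k)%N; last first.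
    by rewrite (dhomog_nemf_coeff _ dm) // (slice_homog hF Vg).
  by apply/eqP/Hu => //; apply: leq_trans le; rewrite key_ltM.
apply/mapP; exists (u - Z_ k)%MM; last by rewrite addmC submK // Z_le.
have hq : q \is d.-homog.
  by apply: (@mulX_homog _ (Z_ k)); rewrite -eg mdeg_Z; exact: slice_homog Vg.
have du' : mdeg (u - Z_ k)%MM = d.
  apply: (@mdeg_addI _ (Z_ k)); rewrite mdeg_Z.
  by rewrite addmC submK ?Z_le.
rewrite mem_lms key_lt_bound // andbT; apply/lmP; exists q.
  by apply: inj => //; rewrite -eg.
split=> // [|m dm lt].
  by move: gu; rewrite eg coef_mulX Z_le le_k.
have dm' : mdeg (Z_ k + m)%MM = (d + k)%N by rewrite mdegD mdeg_Z dm addnC.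
have := Hu _ dm'; rewrite eg mcoeffMX; apply.
rewrite -[u](submK (m := Z_ k)) ?Z_le // in du *.
move: lt; rewrite (key_lt dm du') (key_lt dm' du) !mnmDE; lia.
Qed.

(** The two cases are surjectivity and injectivity of x_3^k on the quotient. In the first, every
    monomial of x_3-exponent below k is leading; in the second, [rho_mulX_le] bounds the
    dimension. *)
Lemma lef_pows_max_rank d k :
  (count (fun m => key (d + k) m < k * (d + k).+1)%N (mons (d + k)) <=
     rho (V (d + k) lef_pows) (d + k) (k * (d + k).+1))%N \/
  (count in_pows (mons (d + k)) <=
     rho (V (d + k) lef_pows) (d + k) (k * (d + k).+1) + count in_pows (mons d))%N.
Proof.
have shiftLX : shiftL 'X_[Z_ k] = lsum ^+ k :> S.
  have [_ _ X2] := sub3X 'X_i0 'X_i1 lsum.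
  by rewrite /Z_ -mpolyXn rmorphXn /= /shiftL X2.
have [le|lt] := leqP (socle_deg ds) (d * 2 + k); [left|right]; last first.
  rewrite -!rho_lef_pows; apply: rho_mulX_le => [|q hq]; first exact: lef_pows_homog.
  move=> /slice_lef_powsP[_]; rewrite rmorphM /= shiftLX mulrC => H.
  apply/slice_lef_powsP; split=> //; apply: (lsum_injective charK _ (ltnW lt) H).
  by apply: sub3_homog; rewrite ?homogU ?lsum_homog.
rewrite -size_filter /rho; apply: uniq_leq_size => [|u].
  exact: (filter_uniq _ (mons_uniq _)).
rewrite mem_filter mem_mons mem_lms => /andP[lt /eqP du]; rewrite lt andbT.
have hu : ('X_[u] : S) \is (d + k).-homog by rewrite dhomogX /= du.
have [|q hq Hq] := lsum_surjective charK ds_gt0 le (p := shiftL 'X_[u]).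
  by apply: sub3_homog; rewrite ?homogU ?lsum_homog.
(* By surjectivity ['X_[u]] is congruent to a multiple of x_3^k, all of whose monomials come after
   [u] in revlex. *)
apply/lmP; exists ('X_[u] - unshiftL q * 'X_[Z_ k]).
  apply/slice_lef_powsP; split.
    have hX : ('X_[Z_ k] : S) \is k.-homog. by rewrite dhomogX /= mdeg_Z.
    rewrite rpredB //; apply: dhomogM => //.
    by apply: sub3_homog; rewrite ?homogU ?unshiftL_lin.
  by rewrite rmorphB rmorphM /= shiftLX unshiftLK mulrC.
have lt_k : (u i2 < k)%N by rewrite -(key_ltM _ du).
split=> // [|m dm lt_m]; rewrite mcoeffB coef_mulX Z_le mcoeffX.
  by rewrite eqxx leqNgt lt_k subr0 oner_neq0.
have [e|ne] := eqVneq u m; first by rewrite e ltnn in lt_m.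
rewrite leqNgt; suff -> : (m i2 < k)%N by rewrite subrr.
by rewrite -(key_ltM _ dm); exact: ltn_trans lt.
Qed.

End Hilbert.

(** * The generic Hilbert function and the conclusion *)

Section CompleteIntersection.
Variables (K : fieldType) (charK : [pchar K] =i pred0) (ds : 'I_3 -> nat).
Notation S := {mpoly K[3]}.
Notation in_pows := (in_pows ds).
Notation var_pows := (@var_pows K ds).
Notation V := (slice ds predT).
Notation hshift := (@hshift K).
Implicit Types (p q g : S) (m : 'X_{1..3}).

Definition in_pows_of (b : pred 'I_3) m : bool := [exists i, b i && (ds i <= m i)%N].

(** For the family x_i^d_i the monomials in [in_pows_of b] lie in the ideal themselves, so the
    projection to them has full rank. Full rank is an open condition, and [ind_surj] turns it into a
    reduction of any [p]. *)
Lemma generically_complement (b : pred 'I_3) e : generically ds (fun F : 'I_3 -> S =>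
  forall p, exists2 g, slice ds b e F g &
    forall m, mdeg m = e -> in_pows_of b m -> (p - g)@_m = 0).
Proof.
have ind0 : ind_ge (slice ds b e var_pows) (in_pows_of b) (count (in_pows_of b) (mons e)).
  rewrite -size_filter; set t := [seq m <- _ | _].
  have ut : uniq t by exact: (filter_uniq _ (mons_uniq e)).
  have ht i : (i < size t)%N -> in_pows_of b (nth 0%MM t i) /\ mdeg (nth 0%MM t i) = e.
    by move/(mem_nth 0%MM); rewrite mem_filter mem_mons => /andP[? /eqP].
  exists (fun i => 'X_[nth 0%MM t i]) => [i|a Ha i].
    have [/existsP[j /andP[bj le]] <-] := ht _ (ltn_ord i); exact: slice_var_powsX bj le.
  have [ti _] := ht _ (ltn_ord i); move: (Ha _ ti).
  rewrite mcoeff_sumZ (bigD1 i) //= mcoeffX eqxx mulr1 big1 ?addr0 // => j ne_ji.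
  rewrite mcoeffX; case: eqP => [/eqP|_]; last by rewrite mulr0.
  by rewrite nth_uniq // => /eqP/val_inj e_ji; rewrite e_ji eqxx in ne_ji.
apply: generically_imp (generically_ind_ge (@var_pows_homog K ds) ind0) _ => F hF ind p.
exact: (ind_surj (slice_lin ds b e F) (fun g => slice_homog hF (g := g)) ind).
Qed.

(* The coefficient of the i-th generator can be reduced modulo the previous
   generators, up to a Koszul correction. *)
Lemma reduce_coef (b : pred 'I_3) d i F p : homs ds F ->
  (forall p, exists2 g, slice ds b (d - ds i) F g &
     forall m, mdeg m = (d - ds i)%N -> in_pows_of b m -> (p - g)@_m = 0) ->
  hshift d (ds i) p ->
  exists h q, [/\ forall j, hshift d (ds j) (h j), hshift d (ds i) q,
    forall m, in_pows_of b m -> q@_m = 0 &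
    p * F i = \sum_(j | b j) h j * F j + q * F i].
Proof.
move=> hF Hb hp; case: (leqP (ds i) d) => [le|lt]; last first.
  exists (fun=> 0), 0; rewrite (hshift_eq0 hp lt) big1 => [|j _]; last by rewrite mul0r.
  by split=> [j||m _|]; rewrite ?mul0r ?addr0 ?mcoeff0 //; exact: hshift0.
have [g [h Hh eg] Hg] := Hb p.
have shi j q : hshift (d - ds i) (ds j) q -> hshift d (ds j) (q * F i).
  move=> hq; rewrite mulrC; apply: hshiftM hq.
  by have := homog_hshift (d - ds i) (hF i); rewrite subnKC.
have hq : p - g \is (d - ds i).-homog.
  rewrite rpredB // ?(hshift_homog hp) // eg.
  by apply: slice_homog hF _; exists h.
exists (fun j => h j * F i), (p - g); split=> [j|||].
- exact: shi.
- by rewrite -{1}(subnK le); exact: homog_hshift.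
- move=> m Tm; have [/eqP dm|dm] := boolP (mdeg m == d - ds i)%N; first exact: Hg.
  by rewrite (dhomog_nemf_coeff hq dm).
rewrite mulrBl; suff -> : \sum_(j | b j) h j * F i * F j = g * F i.
  by rewrite addrC subrK.
by rewrite eg mulr_suml; apply: eq_bigr => j _; rewrite mulrAC.
Qed.

Lemma mdeg_addU i m : mdeg (m + U_(i) *+ ds i)%MM = (mdeg m + ds i)%N.
Proof. by rewrite mdegD mdegMn mdeg1 mul1n. Qed.

(** The last branch is a default, correct for the monomials in [in_pows]. *)
Definition first_ge m : 'I_3 :=
  if (ds i0 <= m i0)%N then i0 else if (ds i1 <= m i1)%N then i1 else i2.

(** The products [G m], one for each monomial of degree d in [in_pows], span the degree-d part.
    Their number therefore bounds its dimension. *)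
Lemma generically_rho_le d : generically ds (fun F : 'I_3 -> S =>
  rho (V d F) d (key_bound d) <= count in_pows (mons d))%N.
Proof.
have H1 := generically_complement (pred1 i0) (d - ds i1).
have H2 := generically_complement (predC1 i2) (d - ds i2).
apply: generically_imp (generically_and charK H1 H2) _ => F hF [{}H1 {}H2].
rewrite -size_filter; set t := [seq m <- _ | _].
pose G m := 'X_[m - U_(first_ge m) *+ ds (first_ge m)] * F (first_ge m).
pose Sp g := exists c : 'X_{1..3} -> K, g = \sum_(m <- t) c m *: G m.
have Sp0 : Sp 0 by exists (fun=> 0); rewrite big1 // => m _; rewrite scale0r.
have SpP c g h : Sp g -> Sp h -> Sp (c *: g + h).
  move=> [u ->] [v ->]; exists (fun m => c * u m + v m).
  rewrite scaler_sumr -big_split; apply: eq_bigr => m _ /=.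
  by rewrite scalerDl scalerA.
have SpG m : m \in t -> Sp (G m).
  move=> tm; exists (fun k => (k == m)%:R).
  rewrite (bigD1_seq m) //=; last exact: (filter_uniq _ (mons_uniq d)).
  by rewrite eqxx scale1r big1 ?addr0 // => k /negPf ->; rewrite scale0r.
have Sp_term i p : hshift d (ds i) p ->
    (forall m, p@_m != 0 -> first_ge (m + U_(i) *+ ds i)%MM = i) -> Sp (p * F i).
  move=> hp Hp; rewrite (mpolyE p) mulr_suml big_seq.
  elim/big_rec: _ => // m x; rewrite mcoeff_msupp => pm Sx.
  rewrite -scalerAl; apply: SpP => //.
  have -> : 'X_[m] * F i = G (m + U_(i) *+ ds i)%MM by rewrite /G Hp // addmK.
  apply: SpG; rewrite mem_filter mem_mons mdeg_addU hp // eqxx andbT.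
  by apply/existsP; exists i; rewrite mnmDE mulmnE mnm1E eqxx mul1n leq_addl.
have SpV g : V d F g -> Sp g.
  case=> h Hh ->; rewrite !big_ord_recl big_ord0 addr0.
  have -> : lift ord0 (lift ord0 ord0) = i2 by apply/val_inj.
  have -> : lift ord0 ord0 = i1 by apply/val_inj.
  (* The coefficient of [F i2] is reduced modulo the first two generators, then the corrected
     coefficient of [F i1] modulo the first. What remains has only monomials for which the
     generator's own index is [first_ge]. *)
  have [u [q2 [Hu Hq2 q20 ->]]] := reduce_coef hF H2 (Hh i2).
  have -> : \sum_(j | predC1 i2 j) u j * F j = u i0 * F i0 + u i1 * F i1.
    rewrite big_mkcond !big_ord_recl big_ord0 /= !addr0.
    by congr (u _ * F _ + u _ * F _); apply/val_inj.
  have -> : h ord0 * F ord0 + (h i1 * F i1 + (u i0 * F i0 + u i1 * F i1 + q2 * F i2)) =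
     (h ord0 + u i0) * F i0 + ((h i1 + u i1) * F i1 + q2 * F i2) by ring.
  have [|v [q1 [Hv Hq1 q10 ->]]] := reduce_coef hF H1 (p := h i1 + u i1).
    exact: hshiftD.
  rewrite big_pred1_eq.
  have -> : (h ord0 + u i0) * F i0 + (v i0 * F i0 + q1 * F i1 + q2 * F i2) =
     1 *: ((h i0 + u i0 + v i0) * F i0) + (1 *: (q1 * F i1) + q2 * F i2).
    by rewrite !scale1r; ring.
  apply: (SpP); last apply: SpP.
  - apply: Sp_term => [|m _]; first by do !apply: hshiftD.
    by rewrite /first_ge mnmDE mulmnE mnm1E eqxx mul1n leq_addl.
  - apply: Sp_term => // m qm; rewrite /first_ge !mnmDE !mulmnE !mnm1E /= !mul0n addn0.
    rewrite mul1n leq_addl leqNgt.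
    suff -> : (m i0 < ds i0)%N by [].
    rewrite ltnNge; apply: contra qm => le; apply/eqP/q10.
    by apply/existsP; exists i0; apply/andP.
  - apply: Sp_term => // m qm; rewrite /first_ge !mnmDE !mulmnE !mnm1E /= !mul0n !addn0.
    have lt j : j != i2 -> (ds j <= m j)%N = false.
      move=> ne; apply: contraNF qm => le; apply/eqP/q20.
      by apply/existsP; exists j; rewrite /= ne.
    by rewrite !lt.
have [g Vg indg] := ind_rho (V d F) d (key_bound d).
have [c Hc] : exists c : 'I_(rho (V d F) d (key_bound d)) -> 'X_{1..3} -> K,
    forall i, g i = \sum_(m <- t) c i m *: G m.
  have [|c Hc] := @fin_all_exists 'I_(rho (V d F) d (key_bound d)) (fun=> 'X_{1..3} -> K)
    (fun i c => g i = \sum_(m <- t) c m *: G m); last by exists c.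
  by move=> i; exact: SpV.
rewrite leqNgt; apply/negP => lt.
(* More than [size t] elements in the span of [size t] products satisfy a nontrivial relation. *)
have [a [i ai] Ha] := left_kernel (fun i (j : 'I_(size t)) => c i (nth 0%MM t j)) lt.
case/eqP: ai; apply: indg => m _; suff -> : \sum_i a i *: g i = 0 by rewrite mcoeff0.
under eq_bigr do rewrite Hc (big_nth 0%MM) big_mkord scaler_sumr.
rewrite exchange_big big1 //= => j _.
under eq_bigr do rewrite scalerA.
by rewrite -scaler_suml Ha scale0r.
Qed.

End CompleteIntersection.

(** * From maximal ranks to the almost reverse lexicographic property *)

Section Conclusion.
Variables (K : fieldType) (charK : [pchar K] =i pred0) (ds : 'I_3 -> nat).
Hypothesis ds_gt0 : forall i, (0 < ds i)%N.
Notation S := {mpoly K[3]}.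
Notation in_pows := (in_pows ds).
Notation V := (slice ds predT).
Implicit Types (F : 'I_3 -> S) (m u v w : 'X_{1..3}).

Lemma generically_forall n (P : nat -> ('I_3 -> S) -> Prop) :
  (forall i, generically ds (P i)) -> generically ds (fun F => forall i, (i < n)%N -> P i F).
Proof.
move=> HP; elim: n => [|n IH].
  exists (fun=> 1); first exact: polyfunC.
  split=> //; exists (fun=> 0); [by move=> i; exact: dhomog0|exact: oner_neq0].
apply: generically_imp (generically_and charK IH (HP n)) _ => F _ [H Hn] i.
by rewrite ltnS leq_eqVlt => /orP[/eqP ->|/H].
Qed.

(** Only finitely many d and N occur, so this is a finite intersection of open conditions; (D+2)^2
    exceeds [key_bound d] for all d <= D. *)
Definition max_rho D F : Prop := forall d N F', (d < D.+1)%N -> (N < D.+2 * D.+2)%N ->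
  homs ds F' -> (rho (V d F') d N <= rho (V d F) d N)%N.

Lemma generically_max_rho D : generically ds (max_rho D).
Proof.
apply: generically_imp (generically_forall D.+1 (fun d => generically_forall (D.+2 * D.+2) (fun N =>
  generically_max_ind K ds predT d (fun m => key d m < N)%N))) _ => F hF H d N F' ld lN hF'.
apply: rho_ge; [exact: slice_lin|by move=> g; exact: slice_homog|].
exact: H _ ld _ lN _ _ hF' (ind_rho _ _ _).
Qed.

Lemma ex_divisor D m : (D <= mdeg m)%N -> exists2 w, (w <= m)%MM & mdeg w = D.
Proof.
elim: D => [|D IH] le; first by exists 0%MM; rewrite ?mdeg0 //; apply/mnm_lepP => i; rewrite mnm0E.
have [w /mnm_lepP lew dw] := IH (ltnW le).
have [i lt] : exists i, (w i < m i)%N.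
  apply: NNPP => H; move: le; rewrite -dw !mdegE ltnNge => /negP; apply.
  by apply: leq_sum => i _; rewrite leqNgt; apply/negP => ?; apply: H; exists i.
exists (w + U_(i))%MM; last by rewrite mdegD mdeg1 dw addn1.
apply/mnm_lepP => j; rewrite mnmDE mnm1E; case: eqP => [<-|_].
  by rewrite addn1.
by rewrite addn0.
Qed.

Lemma size_key_interval d a n (l : seq 'X_{1..3}) : uniq l ->
  (forall m, m \in l -> mdeg m = d /\ (a <= key d m < a + n)%N) -> (size l <= n)%N.
Proof.
move=> ul Hl; rewrite -(size_iota a n) -(size_map (key d)).
apply: uniq_leq_size => [|x /mapP[m /Hl[_ lt] ->]]; last by rewrite mem_iota.
rewrite map_inj_in_uniq // => m m' /Hl[dm _] /Hl[dm' _]; exact: key_inj.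
Qed.

Lemma lm_mdeg F d m : lm (V d F) d m -> mdeg m = d.
Proof. by case/lmP => g _ []. Qed.

Lemma max_almost_revlex F : homs ds F -> max_rho (socle_deg ds).+1 F ->
  (forall d, (d < (socle_deg ds).+2)%N ->
     rho (V d F) d (key_bound d) <= count in_pows (mons d))%N ->
  almost_revlex (initial_ideal (ideal_gen (gens F))).
Proof.
move=> hF maxF leF u [Ju min_u] v dv gt_vu.
set D := (socle_deg ds).+1 in maxF; set d := mdeg u in dv.
have boundN d' N : (d' <= D)%N -> (N <= key_bound d')%N -> (N < D.+2 * D.+2)%N.
  by rewrite /key_bound => le /leq_ltn_trans -> //; nia.
have ge_lef_pows d' : (d' <= D)%N -> (count in_pows (mons d') <= rho (V d' F) d' (key_bound d'))%N.
  move=> le; rewrite -(rho_lef_pows K ds d'); apply: maxF => //; last exact: lef_pows_homog.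
  exact: boundN le _.
(* Degree [D] is just above the socle degree: all its monomials are in [in_pows], so maximality
   makes all of them leading, and no minimal generator has larger degree. *)
have le_dD : (d <= D)%N.
  rewrite leqNgt; apply/negP => lt; have [w le_w dw] := ex_divisor (ltnW lt).
  apply: (min_u _ le_w); first by apply/eqP => E; move: lt; rewrite /d -E dw ltnn.
  apply/(initial_idealP _ hF); rewrite dw.
  have sub : {subset lms (V D F) D (key_bound D) <= mons D}.
    by move=> m; rewrite mem_lms mem_mons => /andP[/lm_mdeg -> _].
  have [|_ E] := uniq_min_size (lms_uniq _ _ _) sub.
    apply: leq_trans (ge_lef_pows _ (leqnn _)).
    have : all in_pows (mons D).
      by apply/allP => m; rewrite mem_mons => /eqP dm; apply: in_pows_large; rewrite ?dm.
    by rewrite all_count => /eqP ->.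
  by have := mem_mons D w; rewrite -E mem_lms dw eqxx => /andP[].
have du : mdeg u = d by [].
have lmu : lm (V d F) d u by apply/(initial_idealP _ hF).
apply/(initial_idealP _ hF); rewrite dv; apply: contraT => lmv.
move: gt_vu; rewrite (revlex_gtE dv du) (key_lt dv du) => /orP[lt2|/andP[/eqP e2 lt1]].
  (* With this k, [v] is among the monomials of x_3-exponent below k, while x_3^k divides [u]. *)
  set k := (v i2).+1 in lt2; have le_kd : (k <= d)%N.
    by apply: leq_trans lt2 _; rewrite -du mdeg3; lia.
  have [e ed] : exists e, d = (e + k)%N by exists (d - k)%N; rewrite subnK.
  have le_e : (e <= D)%N by lia.
  have lev : (key d v < k * d.+1)%N by rewrite key_ltM.
  have leu : (k * d.+1 <= key d u)%N by rewrite leqNgt key_ltM // -leqNgt.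
  have lek : (k * d.+1 <= key_bound d)%N by rewrite /key_bound leq_mul2r ltnW.
  have le_max := maxF d _ _ le_dD (boundN _ _ le_dD lek) (@lef_pows_homog K ds).
  have := lef_pows_max_rank charK ds_gt0 e k; rewrite -ed => -[H|H].
    (* Surjective case: all monomials of x_3-exponent below k are leading, among them [v]. *)
    have sub : {subset lms (V d F) d (k * d.+1) <=
        [seq m <- mons d | (key d m < k * d.+1)%N]}.
      move=> m; rewrite mem_lms mem_filter mem_mons => /andP[/lm_mdeg -> ->].
      by rewrite eqxx.
    have [|_ E] := uniq_min_size (lms_uniq _ _ _) sub.
      by rewrite size_filter; exact: leq_trans H le_max.
    have := E v; rewrite mem_lms mem_filter mem_mons lev dv eqxx.
    by rewrite (negPf lmv).
  (* Injective case: by counting, the leading monomials of x_3-exponent below k and the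
     x_3^k-multiples of those of degree e exhaust degree d. So [u] / x_3^k is leading, against
     minimality. *)
  pose l := lms (V d F) d (k * d.+1) ++ [seq (Z_ k + m)%MM | m <- lms (V e F) e (key_bound e)].
  have shiftP m : m \in lms (V e F) e (key_bound e) ->
      lm (V d F) d (Z_ k + m)%MM /\ ~~ (key d (Z_ k + m)%MM < k * d.+1)%N.
    rewrite mem_lms => /andP[lmm _].
    have lm' : lm (V d F) d (Z_ k + m)%MM.
      by have := lm_mulX (Z_ k) lmm; rewrite mdeg_Z -ed.
    split=> //; rewrite (key_ltM _ (lm_mdeg lm')) mnmDE -leqNgt.
    by apply: leq_trans (leq_addr _ _); rewrite -Z_le lepm_refl.
  have ul : uniq l.
    rewrite cat_uniq lms_uniq map_inj_uniq ?lms_uniq ?andbT; last exact: addmI.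
    apply/hasPn => _ /mapP[m /shiftP[_ nlt] ->].
    by rewrite /= mem_lms (negPf nlt) andbF.
  have sub : {subset l <= lms (V d F) d (key_bound d)}.
    move=> m; rewrite mem_cat => /orP[|/mapP[m' /shiftP[lmm _] ->]]; rewrite !mem_lms.
      by case/andP => lmm _; rewrite lmm key_lt_bound // (lm_mdeg lmm).
    by rewrite lmm key_lt_bound // (lm_mdeg lmm).
  have [|_ E] := uniq_min_size ul sub.
    rewrite size_cat size_map; apply: leq_trans (leF d _) _ => //.
    by apply: leq_trans H _; apply: leq_add le_max (ge_lef_pows _ le_e).
  have := E u; rewrite mem_lms lmu key_lt_bound // mem_cat mem_lms lmu ltnNge leu /=.
  case/mapP => w lw eu; exfalso; apply: (min_u w).
  - by rewrite eu lem_addl.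
  - apply/eqP => /(congr1 (@mdeg 3)); rewrite eu mdegD mdeg_Z /k; lia.
  move: lw; rewrite mem_lms => /andP[lmw _]; apply/(initial_idealP _ hF).
  by rewrite (lm_mdeg lmw).
set k := u i2 in e2.
pose A := lms (V d F) d (k * d.+1).
pose B := [seq m <- lms (V d F) d (k.+1 * d.+1) | (k * d.+1 <= key d m)%N].
have uA : uniq A by exact: lms_uniq.
have uB : uniq B by exact: (filter_uniq _ (lms_uniq _ _ _)).
have HA m : m \in A -> lm (V d F) d m /\ (key d m < k * d.+1)%N.
  by rewrite mem_lms => /andP.
have HB m : m \in B -> lm (V d F) d m /\ (k * d.+1 <= key d m < k.+1 * d.+1)%N.
  by rewrite mem_filter mem_lms => /andP[-> /andP[-> ->]].
have memB m : lm (V d F) d m -> (k * d.+1 <= key d m < k.+1 * d.+1)%N -> m \in B.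
  by move=> lmm /andP[le lt]; rewrite mem_filter mem_lms le lmm lt.
have bnd_u : (u i1 <= d)%N /\ (k <= d)%N by rewrite /k -du mdeg3; lia.
have key_u : key d u = (k * d.+1 + u i1)%N by [].
have key_v : key d v = (k * d.+1 + v i1)%N by rewrite /key e2.
(* [N] is one more than the key of [v], so keys below [N] run up to [v] and stop before [u]. *)
set j := (v i1).+1; pose N := (k * d.+1 + j)%N.
have leN : (N <= key_bound d)%N by rewrite /N /key_bound /j; nia.
have leN1 : (N <= k.+1 * d.+1)%N by rewrite /N /j; nia.
pose B' := take j B.
have [c /rho_ge] : exists c, ind_ge (V d (fun i => shear c (F i)))
    (fun m => key d m < N)%N (size A + size B').
  apply: (ind_shear charK uA _ hF HA) => [|m /mem_take|]; first exact: take_uniq.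
    exact: HB.
  by rewrite size_take; case: ltnP.
have hsF : homs ds (fun i => shear c (F i)) by move=> i; exact: shear_homog.
move=> /(_ (slice_lin _ _ _ _) (fun g => slice_homog hsF (g := g))) ge_rho.
have {ge_rho} ge_rho : (size A + size B' <= rho (V d F) d N)%N.
  by apply: leq_trans ge_rho (maxF _ _ _ le_dD _ hsF); exact: boundN leN.
(* If [B] has at most j members, [A] and [B] already account for all leading monomials below [N],
   although [u] is in [B] with key at least [N]. *)
have [leB|ltB] := leqP (size B) j.
  have eB : B' = B by rewrite /B' take_oversize.
  have sub : {subset lms (V d F) d N <= A ++ B}.
    move=> m; rewrite mem_lms mem_cat => /andP[lmm ltm].
    case: (ltnP (key d m) (k * d.+1)) => [lt|le]; first by rewrite mem_lms lmm lt.
    by rewrite memB ?orbT // le (leq_trans ltm).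
  have [|_ E] := uniq_min_size (lms_uniq _ _ _) sub.
    by rewrite size_cat -eB.
  have := E u; rewrite mem_cat mem_lms lmu key_u /N ltn_add2l ltnNge lt1 /=.
  by rewrite memB ?orbT // key_u; nia.
have sB' : size B' = j by rewrite /B' size_takel // ltnW.
(* Otherwise at least j leading monomials of x_3-exponent k would be needed below [N]; only j keys
   are available, and that of [v] is excluded. *)
pose C := [seq m <- mons d | (k * d.+1 <= key d m < k * d.+1 + v i1)%N].
have sC : (size C <= v i1)%N.
  apply: (@size_key_interval d (k * d.+1)); first exact: (filter_uniq _ (mons_uniq _)).
  by move=> m; rewrite mem_filter mem_mons => /andP[? /eqP].
have : (rho (V d F) d N <= size (A ++ C))%N.
  apply: uniq_leq_size => [|m]; first exact: lms_uniq.
  rewrite mem_lms mem_cat => /andP[lmm ltm]; have dm := lm_mdeg lmm.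
  case: (ltnP (key d m) (k * d.+1)) => [lt|le]; first by rewrite mem_lms lmm lt.
  apply/orP; right; rewrite mem_filter mem_mons dm eqxx andbT le /=.
  move: ltm; rewrite /N /j addnS ltnS leq_eqVlt => /orP[/eqP e|->] //.
  by case/negP: lmv; rewrite -(key_inj dm dv) // e key_v.
move: ge_rho; rewrite sB' size_cat /j; lia.
Qed.

End Conclusion.

Theorem theorem1p2 (K : fieldType) (charK : [pchar K] =i pred0)
  (d1 d2 d3 : nat) (hd1 : (0 < d1)%N) (hd2 : (0 < d2)%N) (hd3 : (0 < d3)%N) :
  generic d1 d2 d3
    (fun f1 f2 f3 : {mpoly K[3]} =>
       almost_revlex (initial_ideal (ideal_gen (fun q => q = f1 \/ q = f2 \/ q = f3)))).
Proof.
pose ds (i : 'I_3) := nth 0%N [:: d1; d2; d3] i.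
have ds_gt0 i : (0 < ds i)%N by move: i; apply: ord3P.
pose tri (f1 f2 f3 : {mpoly K[3]}) (i : 'I_3) := nth 0 [:: f1; f2; f3] i.
have [phi [Q HQ] [[F hF F0] HF]] : generically ds (fun F : 'I_3 -> {mpoly K[3]} =>
    almost_revlex (initial_ideal (ideal_gen (gens F)))).
  have G1 := generically_max_rho charK ds (socle_deg ds).+1.
  have G2 := generically_forall charK (socle_deg ds).+2 (generically_rho_le charK ds).
  apply: generically_imp (generically_and charK G1 G2) _ => F hF [H1 H2].
  exact: (max_almost_revlex charK ds_gt0 hF H1 H2).
have triP f1 f2 f3 : in_space d1 d2 d3 f1 f2 f3 -> homs ds (tri f1 f2 f3).
  by move=> [h1 [h2 h3]]; apply: ord3P.
exists (fun f1 f2 f3 => phi (tri f1 f2 f3) != 0); split; last split.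
- exists (fun P => P = Q) => f1 f2 f3 /triP hf; rewrite (HQ _ hf).
  by split=> [H|[P [-> H]]] //; exists Q.
- have sF : in_space d1 d2 d3 (F 0) (F 1) (F 2%:R) by split; [|split]; exact: hF.
  exists (F 0), (F 1), (F 2%:R); split=> //; rewrite (HQ _ (triP _ _ _ sF)).
  by rewrite (HQ _ hF) in F0.
by move=> f1 f2 f3 /triP hf /(HF _ hf).
Qed.
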